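(* Let $n\ge1$. For every infinite c.e. set $A\subseteq\omega$, the numbering ${}^A\psi^{(n)}$ obtained from the modified Turing programs (see context) is a quasi-Gödel numbering of $\mathcal S^{(n)}_A$.
   Context: $\omega$ is the set of natural numbers. $\mathcal P^{(n)}$, $\mathcal R^{(n)}$ are the sets of $n$-ary partial, respectively total, computable functions on $\omega$. $\langle\cdot,\cdot\rangle:\omega^2\to\omega$ is a computable bijection with $\langle x,y\rangle\ge x,y$, extended by $\langle x\rangle=x$, $\langle x_1,\dots,x_{n+1}\rangle=\langle x_1,\langle x_2,\dots,x_{n+1}\rangle\rangle$. For $A\subseteq\omega$, $\mathrm{Anf}^{(n)}_A$ is the set of partial functions $\omega^n\to\omega$ whose domain is either empty or equal to $\{0,\dots,a-1\}^n$ for some $a\in A$ (an initial segment of $\omega^n$ of edge length $a$), and $\mathcal S^{(n)}_A=\mathcal R^{(n)}\cup\mathrm{Anf}^{(n)}_A$. The extended graph of an $n$-ary partial function $q$ is $\{\langle\langle\vec y\rangle,0\rangle:\vec y\in\omega^n\}\cup\{\langle\langle\vec x\rangle,q(\vec x)+1\rangle:\vec x\in\mathrm{dom}(q)\}$. A numbering of a set $X$ is a surjection $\omega\to X$. A numbering $\theta$ of $\mathcal S^{(n)}_A$ is a quasi-Gödel numbering if: (QGN I) the extended graph of $(i,\vec x)\mapsto\theta_i(\vec x)$ is the range of a function in $\mathcal R^{(1)}$; and (QGN II) for every $k\in\mathcal R^{(2)}$ there is $v\in\mathcal R^{(1)}$ such that for all $i\in\omega$, $r\in\mathcal S^{(n)}_A$: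 if $\{k(i,t):t\in\omega\}$ is the extended graph of $r$, then $r=\theta_{v(i)}$. Machine model. Fix a finite tape alphabet $\Sigma$, let $\mathrm{TP}_\Sigma$ be the set of all Turing programs with tape alphabet $\Sigma$, and let $\mathrm{Sem}^{(n)}:\mathrm{TP}_\Sigma\to\mathcal P^{(n)}$ be the map assigning to a program the $n$-ary function it computes under a fixed standard input/output convention (so $\mathrm{Sem}^{(n)}$ is onto $\mathcal P^{(n)}$). Fix an effective enumeration $\kappa:\omega\to\omega^n$ without repetitions and an effective enumeration of $A$, and let $A_j$ be the finite part of $A$ enumerated after $j$ steps. For $P\in\mathrm{TP}_\Sigma$, $M^{(n)}_A(P)$ is the Turing program, containing $P$ as a subprogram, that realises the following algorithm on input $\vec x$: for $j=1,2,3,\dots$ in turn, compute $A_j$ and run $P$ on inputs $\kappa(0),\dots,\kappa(j-1)$ for $j$ steps each; if there is $a\in A_j$ with $\vec x\in\{0,\dots,a-1\}^n$ such that every $\vec y\in\{0,\dots,a-1\}^n$ is among $\kappa(0),\dots,\kappa(j-1)$ and $P$ stops on $\vec y$ within $j$ steps, then output the result of $P$ on input $\vec x$ and halt; otherwise go on to $j+1$. Let $(\mathrm{MP}_i)_{i\in\omega}$ be an effective one-to-one enumeration of the set $\{M^{(n)}_A(P):P\in\mathrm{TP}_\Sigma\}$ of modified programs, and put ${}^A\psi^{(n)}_i=\mathrm{Sem}^{(n)}(\mathrm{MP}_i)$. *)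

(* Defs.v *)
From mathcomp Require Import all_boot.
From mathcomp Require Import boolp classical_sets cardinality.

Set Implicit Arguments.
Unset Strict Implicit.
Unset Printing Implicit Defensive.

Local Open Scope nat_scope.
Local Open Scope classical_set_scope.

(* [None] means undefined. *)
Definition pfun (n : nat) : Type := n.-tuple nat -> option nat.

Definition pdom n (q : pfun n) : set (n.-tuple nat) := [set x | isSome (q x)].

(* The partial recursive functions: the least class containing the initial
   functions and closed under substitution, primitive recursion and
   minimisation.  The closure rules take any [h] satisfying the defining
   equivalence, so no operator on partial functions has to be constructed. *)
Inductive partial_computable : forall n, pfun n -> Prop :=
| pc_zero n :
    partial_computable (fun _ : n.-tuple nat => Some 0)
| pc_succ :
    partial_computable (fun x : 1.-tuple nat => Some (thead x).+1)
| pc_proj n (i : 'I_n) :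
    partial_computable (fun x : n.-tuple nat => Some (tnth x i))
| pc_comp m n (f : pfun m) (g : 'I_m -> pfun n) (h : pfun n) :
    partial_computable f ->
    (forall i, partial_computable (g i)) ->
    (forall x y, h x = Some y <->
       exists z : m.-tuple nat,
         (forall i, g i x = Some (tnth z i)) /\ f z = Some y) ->
    partial_computable h
| pc_rec n (f : pfun n) (g : pfun n.+2) (h : pfun n.+1) :
    partial_computable f ->
    partial_computable g ->
    (forall x : n.-tuple nat, h [tuple of 0 :: x] = f x) ->
    (forall i (x : n.-tuple nat),
       h [tuple of i.+1 :: x]
       = obind (fun w => g [tuple of i :: w :: x]) (h [tuple of i :: x])) ->
    partial_computable h
| pc_min n (f : pfun n.+1) (h : pfun n) :
    partial_computable f ->
    (forall (x : n.-tuple nat) y, h x = Some y <->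
       f [tuple of y :: x] = Some 0 /\
       forall z, z < y -> exists w, f [tuple of z :: x] = Some w.+1) ->
    partial_computable h.

Definition total_computable n : set (pfun n) :=
  [set q | partial_computable q /\ pdom q = setT].
Arguments total_computable : clear implicits.

Definition computable1 (f : nat -> nat) : Prop :=
  partial_computable (fun x : 1.-tuple nat => Some (f (thead x))).

Definition computable2 (f : nat -> nat -> nat) : Prop :=
  partial_computable
    (fun x : 2.-tuple nat => Some (f (tnth x ord0) (tnth x ord_max))).

Definition computable_pairing (pr : nat -> nat -> nat) : Prop :=
  [/\ computable2 pr,
      bijective (fun z : nat * nat => pr z.1 z.2) &
      forall x y, x <= pr x y /\ y <= pr x y].

(* <x> = x and <x_1, ..., x_{n+1}> = <x_1, <x_2, ..., x_{n+1}>>; the value on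
   the empty sequence is never used. *)
Fixpoint seq_pairing (pr : nat -> nat -> nat) (s : seq nat) : nat :=
  match s with
  | [::] => 0
  | [:: x] => x
  | x :: s' => pr x (seq_pairing pr s')
  end.

Definition effective_enumeration (e : nat -> nat) (A : set nat) : Prop :=
  computable1 e /\ range e = A.

(* The finite part A_j of A, one value of [e] per step. *)
Definition enumerated_part (e : nat -> nat) (j : nat) : set nat :=
  [set a | exists2 t, t < j & a = e t].

Definition effective_tuple_enumeration n (kappa : nat -> n.-tuple nat) : Prop :=
  (forall i : 'I_n, computable1 (fun t => tnth (kappa t) i)) /\
  bijective kappa.

Definition cube n (a : nat) : set (n.-tuple nat) :=
  [set x | forall i, tnth x i < a].
Arguments cube : clear implicits.

Definition Anf n (A : set nat) : set (pfun n) :=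
  [set q | pdom q = set0 \/ exists2 a, A a & pdom q = cube n a].
Arguments Anf : clear implicits.

Definition SA n (A : set nat) : set (pfun n) :=
  total_computable n `|` Anf n A.
Arguments SA : clear implicits.

Definition extended_graph (pr : nat -> nat -> nat) n (q : pfun n) : set nat :=
  [set z | exists y : n.-tuple nat, z = pr (seq_pairing pr y) 0] `|`
  [set z | exists (x : n.-tuple nat) (v : nat),
             q x = Some v /\ z = pr (seq_pairing pr x) v.+1].

(* (i, x) |-> theta_i(x) *)
Definition universal n (theta : nat -> pfun n) : pfun n.+1 :=
  fun z => theta (thead z) [tuple of behead z].

Definition QGN_I (pr : nat -> nat -> nat) n (theta : nat -> pfun n) : Prop :=
  exists2 f, computable1 f & range f = extended_graph pr (universal theta).

Definition QGN_II (pr : nat -> nat -> nat) n (A : set nat)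
    (theta : nat -> pfun n) : Prop :=
  forall k : nat -> nat -> nat, computable2 k ->
  exists2 v, computable1 v &
    forall (i : nat) (r : pfun n), SA n A r ->
      range (k i) = extended_graph pr r -> r = theta (v i).

Definition quasi_goedel_numbering (pr : nat -> nat -> nat) n (A : set nat)
    (theta : nat -> pfun n) : Prop :=
  [/\ range theta = SA n A, QGN_I pr theta & QGN_II pr A theta].

Structure alphabet := Alphabet {
  symbol :> finType;
  blank : symbol;
  stroke : symbol;
  blank_neq_stroke : blank != stroke
}.

Inductive move := Lft | Stay | Rgt.

Record instruction (Sigma : alphabet) := Instruction {
  in_state : nat;
  scanned : Sigma;
  written : Sigma;
  direction : move;
  out_state : nat
}.

(* A program is a list of quintuples; if several apply, the first one in the
   list is executed.  State 0 is initial, and a program halts when no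
   instruction applies. *)
Definition program (Sigma : alphabet) : Type := seq (instruction Sigma).

Fixpoint lookup (Sigma : alphabet) (P : program Sigma) (q : nat) (s : Sigma) :
    option (Sigma * move * nat) :=
  if P is c :: P' then
    if (in_state c == q) && (scanned c == s)
    then Some (written c, direction c, out_state c) else lookup P' q s
  else None.

(* The tape is two-way infinite: [ltape] is the part to the left of the head,
   nearest cell first, [rtape] starts with the cell under the head, and all
   cells beyond the lists are blank. *)
Record config (Sigma : alphabet) := Config {
  cstate : nat;
  ltape : seq Sigma;
  rtape : seq Sigma
}.

Definition head_symbol (Sigma : alphabet) (c : config Sigma) : Sigma :=
  head (blank Sigma) (rtape c).

Definition halted (Sigma : alphabet) (P : program Sigma) (c : config Sigma) :
    bool := ~~ isSome (lookup P (cstate c) (head_symbol c)).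

Definition step (Sigma : alphabet) (P : program Sigma) (c : config Sigma) :
    config Sigma :=
  match lookup P (cstate c) (head_symbol c) with
  | None => c
  | Some (w, d, q) =>
      let l := ltape c in
      let r := w :: behead (rtape c) in
      match d with
      | Lft => Config q (behead l) (head (blank Sigma) l :: r)
      | Stay => Config q l r
      | Rgt => Config q (w :: l) (behead r)
      end
  end.

(* Davis's conventions: the input is the sequence of blocks of x_i + 1 strokes
   separated by single blanks, with the head on the leftmost stroke; the output
   is the number of strokes on the tape when the program halts. *)
Definition input_tape (Sigma : alphabet) (x : seq nat) : seq Sigma :=
  flatten [seq rcons (nseq v.+1 (stroke Sigma)) (blank Sigma) | v <- x].

Definition output (Sigma : alphabet) (c : config Sigma) : nat :=
  count_mem (stroke Sigma) (ltape c) + count_mem (stroke Sigma) (rtape c).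

Definition run (Sigma : alphabet) (P : program Sigma) (x : seq nat) (j : nat) :
    config Sigma :=
  iter j (step P) (Config 0 [::] (input_tape Sigma x)).

Definition stops_within (Sigma : alphabet) (P : program Sigma) (x : seq nat)
    (j : nat) : bool := halted P (run P x j).

Definition Sem (Sigma : alphabet) (n : nat) (P : program Sigma) : pfun n :=
  fun x => match pselect (exists j, stops_within P x j) with
           | left h => Some (output (run P x (ex_minn h)))
           | right _ => None
           end.
Arguments Sem {Sigma} n P _.

(* Goedel numbers of programs; [CodeSeq.code] is the bijection of [seq nat] with
   [nat] from MathComp. *)
Definition move_code (d : move) : nat :=
  match d with Lft => 0 | Stay => 1 | Rgt => 2 end.

Definition instruction_code (Sigma : alphabet) (c : instruction Sigma) : nat :=
  CodeSeq.code [:: in_state c; nat_of_ord (enum_rank (scanned c));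
                   nat_of_ord (enum_rank (written c));
                   move_code (direction c); out_state c].

Definition program_code (Sigma : alphabet) (P : program Sigma) : nat :=
  CodeSeq.code [seq instruction_code c | c <- P].

(* Up to a renaming of states, the instructions executed by [P] are executed
   by [Q]. *)
Definition subprogram (Sigma : alphabet) (P Q : program Sigma) : Prop :=
  exists2 rho : nat -> nat, injective rho &
    forall q s w d q', lookup P q s = Some (w, d, q') ->
                       lookup Q (rho q) s = Some (w, d, rho q').

(* The test performed by the algorithm on input [x] in its [j]-th round: [P]
   stops on [y] exactly when it yields a result, since every halting tape is
   read as an output. *)
Definition round_succeeds (Sigma : alphabet) n (kappa : nat -> n.-tuple nat)
    (e : nat -> nat) (P : program Sigma) (x : n.-tuple nat) (j : nat) : Prop :=
  exists a, [/\ enumerated_part e j a, cube n a x &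
    forall y, cube n a y ->
      (exists2 t, t < j & kappa t = y) /\ stops_within P y j].

(* The partial function described by the algorithm: in the first successful
   round the result of [P] on [x] is returned; if no round succeeds, the
   algorithm runs forever. *)
Definition modified_function (Sigma : alphabet) n (kappa : nat -> n.-tuple nat)
    (e : nat -> nat) (P : program Sigma) : pfun n :=
  fun x => if pselect (exists j, 1 <= j /\ round_succeeds kappa e P x j)
           then Sem n P x else None.

Definition program_modification (Sigma : alphabet) n
    (kappa : nat -> n.-tuple nat) (e : nat -> nat)
    (M : program Sigma -> program Sigma) : Prop :=
  [/\ exists2 f, computable1 f &
        forall P, program_code (M P) = f (program_code P),
      forall P, subprogram P (M P) &
      forall P, Sem n (M P) = modified_function kappa e P].

Definition effective_program_enumeration (Sigma : alphabet)
    (MP : nat -> program Sigma) (X : set (program Sigma)) : Prop :=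
  [/\ computable1 (fun i => program_code (MP i)), injective MP & range MP = X].

(* Main.v *)
(* A run of a program of which only a code is given is simulated by a computable
   function of that code, with half-tapes coded as numbers; dovetailing over the
   number of steps enumerates the extended graph (QGN I), and a total function in
   the range of the numbering is computable.  Conversely, on two-symbol unary
   tapes every total computable function is computed by a Turing program, and
   prefixing a program that writes [i] yields an s-m-n theorem: from [i] one
   computes a program [P i] which on input [x] searches for a [t] such that
   [k i t = <<x>, v + 1>] and outputs [v].  If [k i] enumerates the extended graph
   of [r] in S_A, then [P i] computes [r], which the modification leaves unchanged
   as dom [r] is a union of cubes with edges in [A]; the index of [M (P i)] is
   found by searching for its code (QGN II).  The image of [M] consists of the
   restrictions to the unions of cubes with edges in [A] contained in the domain,
   hence of members of S_A; QGN II for a constant enumeration of an extended graph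
   gives surjectivity.

   Since [P i] performs a single unbounded search over a total test, divergence
   has to be analysed only for this loop; the translation of partial computable
   functions into programs only needs to be correct where they are defined. *)

Require Import Defs.
From mathcomp Require Import all_boot zify.
From mathcomp Require Import boolp classical_sets cardinality.

Set Implicit Arguments.
Unset Strict Implicit.
Unset Printing Implicit Defensive.

Local Open Scope nat_scope.
Local Open Scope classical_set_scope.

(** * A calculus of total computable functions *)

(** Total functions act on lists instead of tuples, so that arguments can be added, dropped and
    permuted without casts; only the values on lists of length [n] matter. *)
Definition recursive n (F : seq nat -> nat) : Prop :=
  partial_computable (fun x : n.-tuple nat => Some (F x)).

Lemma recursive_ext n F G :
  (forall s, size s = n -> F s = G s) -> recursive n F -> recursive n G.
Proof.
move=> eqFG recF; rewrite /recursive.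
suff <- : (fun x : n.-tuple nat => Some (F x)) = (fun x => Some (G x)) by [].
by apply: funext => x; rewrite eqFG ?size_tuple.
Qed.

Lemma recursive_computable1 f : recursive 1 (fun s => f (nth 0 s 0)) = computable1 f.
Proof.
rewrite /recursive /computable1.
suff -> : (fun x : 1.-tuple nat => Some (f (nth 0 x 0))) =
          (fun x => Some (f (thead x))) by [].
by apply: funext => x; rewrite /thead (tnth_nth 0).
Qed.

Lemma recursive_computable2 f :
  recursive 2 (fun s => f (nth 0 s 0) (nth 0 s 1)) = computable2 f.
Proof.
rewrite /recursive /computable2.
suff -> : (fun x : 2.-tuple nat => Some (f (nth 0 x 0) (nth 0 x 1))) =
          (fun x => Some (f (tnth x ord0) (tnth x ord_max))) by [].
by apply: funext => x; rewrite !(tnth_nth 0).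
Qed.

Lemma recursive_nth n i : i < n -> recursive n (fun s => nth 0 s i).
Proof.
move=> lt_in; rewrite /recursive.
suff -> : (fun x : n.-tuple nat => Some (nth 0 x i)) =
          (fun x => Some (tnth x (Ordinal lt_in))) by apply: pc_proj.
by apply: funext => x; rewrite (tnth_nth 0).
Qed.

Fixpoint all_recursive n (Gs : seq (seq nat -> nat)) : Prop :=
  if Gs is G :: Gs' then recursive n G /\ all_recursive n Gs' else True.

Lemma all_recursive_nth n Gs i :
  all_recursive n Gs -> i < size Gs -> recursive n (nth (fun=> 0) Gs i).
Proof.
elim: Gs i => [|G Gs IH] [|i] //= [recG recGs]; first by [].
exact: IH.
Qed.

Lemma all_recursive_map n (I : eqType) (r : seq I) (H : I -> seq nat -> nat) :
  (forall i, i \in r -> recursive n (H i)) -> all_recursive n [seq H i | i <- r].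
Proof.
elim: r => //= i r IH recH; split; first by apply: recH; rewrite mem_head.
by apply: IH => j jr; apply: recH; rewrite inE jr orbT.
Qed.

Lemma recursive_comp n m F Gs : recursive m F -> size Gs = m ->
  all_recursive n Gs -> recursive n (fun s => F [seq G s | G <- Gs]).
Proof.
move=> recF sGs recGs.
apply: (@pc_comp m n _
  (fun i x => Some (nth (fun=> 0) Gs i (tval x)))) recF _ _ => [i|x y].
  by apply: all_recursive_nth; rewrite // sGs.
have tuple_of (z : m.-tuple nat) :
    (forall i : 'I_m, Some (nth (fun=> 0) Gs i x) = Some (tnth z i)) ->
    tval z = [seq G (tval x) | G <- Gs].
  move=> zE; apply: (@eq_from_nth _ 0); rewrite size_tuple ?size_map ?sGs //.
  move=> i lt_im; have := zE (Ordinal lt_im); rewrite (tnth_nth 0) /= => -[<-].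
  by rewrite (nth_map (fun=> 0)) // sGs.
split=> [[<-]|[z [/tuple_of <-]]] //.
have sz : size [seq G (tval x) | G <- Gs] == m by rewrite size_map sGs.
exists (Tuple sz); split=> // i; rewrite (tnth_nth 0) /=.
by rewrite (nth_map (fun=> 0)) // sGs.
Qed.

Lemma recursive_op1 n f F :
  computable1 f -> recursive n F -> recursive n (fun s => f (F s)).
Proof.
rewrite -recursive_computable1 => recf recF.
exact: (recursive_comp (Gs := [:: F]) recf).
Qed.

Lemma recursive_op2 n f F G : computable2 f ->
  recursive n F -> recursive n G -> recursive n (fun s => f (F s) (G s)).
Proof.
rewrite -recursive_computable2 => recf recF recG.
exact: (recursive_comp (Gs := [:: F; G]) recf).
Qed.

Definition computable3 (f : nat -> nat -> nat -> nat) : Prop :=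
  recursive 3 (fun s => f (nth 0 s 0) (nth 0 s 1) (nth 0 s 2)).

Lemma recursive_op3 n f F G H : computable3 f -> recursive n F ->
  recursive n G -> recursive n H -> recursive n (fun s => f (F s) (G s) (H s)).
Proof.
by move=> recf recF recG recH; apply: (recursive_comp (Gs := [:: F; G; H]) recf).
Qed.

Lemma recursive_const n c : recursive n (fun=> c).
Proof.
elim: c => [|c IH]; first exact: pc_zero.
apply: (@recursive_op1 n succn (fun=> c)) => //.
exact: pc_succ.
Qed.

Lemma nth_iota_id (s : seq nat) : [seq nth 0 s i | i <- iota 0 (size s)] = s.
Proof. exact: mkseq_nth. Qed.

Lemma recursive_weaken n F (r : seq nat) : recursive (size r) F ->
  all (fun i => i < n) r -> recursive n (fun s => F [seq nth 0 s i | i <- r]).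
Proof.
move=> recF ltr.
have : recursive n (fun s => F [seq G s | G <- [seq (fun s => nth 0 s i) | i <- r]]).
  apply: (recursive_comp recF); first by rewrite size_map.
  by apply: all_recursive_map => i /(allP ltr); apply: recursive_nth.
by apply: recursive_ext => s _; rewrite -map_comp.
Qed.

Lemma recursive_cons n F G : recursive n.+1 F -> recursive n G ->
  recursive n (fun s => F (G s :: s)).
Proof.
move=> recF recG.
have : recursive n (fun s => F [seq H s | H <- G ::
    [seq (fun s => nth 0 s i) | i <- iota 0 n]]).
  apply: (recursive_comp recF); first by rewrite /= size_map size_iota.
  split=> //; apply: all_recursive_map => i.
  by rewrite mem_iota; apply: recursive_nth.
apply: recursive_ext => s sn /=.
by rewrite -map_comp /comp -sn nth_iota_id.
Qed.

Lemma recursive_behead n F : recursive n F -> recursive n.+1 (fun s => F (behead s)).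
Proof.
move=> recF.
have : recursive n.+1 (fun s => F [seq nth 0 s i | i <- iota 1 n]).
  apply: recursive_weaken; first by rewrite size_iota.
  by apply/allP => i; rewrite mem_iota => /andP[].
apply: recursive_ext => -[|a s] //= [sn].
by rewrite -{2}(nth_iota_id s) -sn -[1]/(1 + 0) iotaDl -map_comp.
Qed.

(** The recursion of [pc_rec] runs over an additional first argument, for which [K s] is substituted
    afterwards. *)
Lemma recursive_rec n F G K :
  recursive n F -> recursive n.+2 G -> recursive n K ->
  recursive n (fun s => nat_rect (fun=> nat) (F s) (fun i w => G [:: i, w & s]) (K s)).
Proof.
move=> recF recG recK.
pose h s := nat_rect (fun=> nat) (F (behead s))
  (fun i w => G [:: i, w & behead s]) (nth 0 s 0).
suff rech : recursive n.+1 h by exact: (recursive_cons rech recK).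
exact: (pc_rec recF recG).
Qed.

Lemma recursive_iter n F G K :
  recursive n F -> recursive n.+1 G -> recursive n K ->
  recursive n (fun s => iter (K s) (fun w => G (w :: s)) (F s)).
Proof.
move=> recF recG recK.
have := recursive_rec recF (recursive_behead recG) recK.
apply: recursive_ext => s _.
by elim: (K s) => //= m ->.
Qed.

(** The result of the search is given beforehand as a total function [G]; the premise makes it the
    least zero of [F], which is what minimisation returns. *)
Lemma recursive_min n F G : recursive n.+1 F ->
  (forall s, size s = n ->
     F (G s :: s) = 0 /\ forall z, z < G s -> F (z :: s) <> 0) ->
  recursive n G.
Proof.
move=> recF minG; apply: (pc_min recF) => x y.
have [FG0 FGlt] := minG x (size_tuple x); split=> [[<-]|[[Fy0] Fylt]].
  split=> [|z /FGlt]; first by congr Some.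
  by case: (F (z :: x)) => [|w] // _; exists w.
case: (ltngtP (G x) y) => [/Fylt[w [Fw]]|/FGlt/(_ Fy0)//|-> //].
by move: Fw; rewrite FG0.
Qed.

(** * Arithmetic *)

Lemma computable_pred : computable1 predn.
Proof.
rewrite -recursive_computable1.
have := @recursive_rec 1 (fun=> 0) (fun s => nth 0 s 0) (fun s => nth 0 s 0)
  (recursive_const 1 0) (@recursive_nth 3 0 isT) (@recursive_nth 1 0 isT).
by apply: recursive_ext => s _; case: (nth 0 s 0).
Qed.

Lemma computable_add : computable2 addn.
Proof.
rewrite -recursive_computable2.
have := @recursive_iter 2 (fun s => nth 0 s 1) (fun s => (nth 0 s 0).+1) (fun s => nth 0 s 0)
  (@recursive_nth 2 1 isT) (recursive_op1 pc_succ (@recursive_nth 3 0 isT))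
  (@recursive_nth 2 0 isT).
by apply: recursive_ext => s _ /=; elim: (nth 0 s 0) => //= m ->.
Qed.

Lemma computable_sub : computable2 subn.
Proof.
rewrite -recursive_computable2.
have := @recursive_iter 2 (fun s => nth 0 s 0) (fun s => (nth 0 s 0).-1) (fun s => nth 0 s 1)
  (@recursive_nth 2 0 isT) (recursive_op1 computable_pred (@recursive_nth 3 0 isT))
  (@recursive_nth 2 1 isT).
by apply: recursive_ext => s _ /=; elim: (nth 0 s 1) => [|m IH] /=; rewrite ?subn0 // IH subnS.
Qed.

Lemma computable_mul : computable2 muln.
Proof.
rewrite -recursive_computable2.
have := @recursive_iter 2 (fun=> 0) (fun s => nth 0 s 2 + nth 0 s 0) (fun s => nth 0 s 0)
  (recursive_const 2 0)
  (recursive_op2 computable_add (@recursive_nth 3 2 isT) (@recursive_nth 3 0 isT))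
  (@recursive_nth 2 0 isT).
by apply: recursive_ext => s _ /=; elim: (nth 0 s 0) => //= m ->; rewrite mulSn.
Qed.

Lemma computable_exp : computable2 expn.
Proof.
rewrite -recursive_computable2.
have := @recursive_iter 2 (fun=> 1) (fun s => nth 0 s 1 * nth 0 s 0) (fun s => nth 0 s 1)
  (recursive_const 2 1)
  (recursive_op2 computable_mul (@recursive_nth 3 1 isT) (@recursive_nth 3 0 isT))
  (@recursive_nth 2 1 isT).
by apply: recursive_ext => s _ /=; elim: (nth 0 s 1) => //= m ->; rewrite expnS.
Qed.

Lemma recursive_leq n F G : recursive n F -> recursive n G ->
  recursive n (fun s => F s <= G s).
Proof.
move=> recF recG.
have := recursive_op2 computable_sub (recursive_const n 1)
  (recursive_op2 computable_sub recF recG).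
by apply: recursive_ext => s _; rewrite /leq; case: (F s - G s).
Qed.

Lemma recursive_and n (b c : seq nat -> bool) : recursive n (fun s => b s) ->
  recursive n (fun s => c s) -> recursive n (fun s => b s && c s).
Proof.
move=> recb recc; have := recursive_op2 computable_mul recb recc.
by apply: recursive_ext => s _; rewrite mulnb.
Qed.

Lemma recursive_neg n (b : seq nat -> bool) : recursive n (fun s => b s) ->
  recursive n (fun s => ~~ b s).
Proof.
move=> recb; have := recursive_op2 computable_sub (recursive_const n 1) recb.
by apply: recursive_ext => s _; case: (b s).
Qed.

Lemma recursive_or n (b c : seq nat -> bool) : recursive n (fun s => b s) ->
  recursive n (fun s => c s) -> recursive n (fun s => b s || c s).
Proof.
move=> recb recc.
have := recursive_neg (recursive_and (recursive_neg recb) (recursive_neg recc)).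
by apply: recursive_ext => s _; rewrite negb_and !negbK.
Qed.

Lemma recursive_eq n F G : recursive n F -> recursive n G ->
  recursive n (fun s => F s == G s).
Proof.
move=> recF recG.
have := recursive_and (recursive_leq recF recG) (recursive_leq recG recF).
by apply: recursive_ext => s _; rewrite eqn_leq.
Qed.

Lemma recursive_if n (b : seq nat -> bool) F G : recursive n (fun s => b s) ->
  recursive n F -> recursive n G -> recursive n (fun s => if b s then F s else G s).
Proof.
move=> recb recF recG.
have := recursive_op2 computable_add (recursive_op2 computable_mul recb recF)
   (recursive_op2 computable_mul (recursive_neg recb) recG).
by apply: recursive_ext => s _; case: (b s); rewrite ?mul1n ?mul0n ?addn0.
Qed.

Ltac recursive_step :=
  match goal with
  | H : recursive ?n ?F |- recursive ?n ?F => exact: H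
  | |- recursive _ (fun=> ?c) => apply: recursive_const
  | |- recursive _ (fun s => nth 0 s _) => apply: recursive_nth; by []
  | |- recursive _ (fun s => addn _ _) => apply: (recursive_op2 computable_add)
  | |- recursive _ (fun s => muln _ _) => apply: (recursive_op2 computable_mul)
  | |- recursive _ (fun s => subn _ _) => apply: (recursive_op2 computable_sub)
  | |- recursive _ (fun s => expn _ _) => apply: (recursive_op2 computable_exp)
  | |- recursive _ (fun s => predn _) => apply: (recursive_op1 computable_pred)
  | |- recursive _ (fun s => S _) => apply: (recursive_op1 pc_succ)
  | |- recursive _ (fun s => nat_of_bool (_ && _)) => apply: recursive_and
  | |- recursive _ (fun s => nat_of_bool (_ || _)) => apply: recursive_or
  | |- recursive _ (fun s => nat_of_bool (~~ _)) => apply: recursive_neg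
  | |- recursive _ (fun s => nat_of_bool (_ == _)) => apply: recursive_eq
  | |- recursive _ (fun s => nat_of_bool (_ <= _)) => apply: recursive_leq
  | |- recursive _ (fun s => if _ then _ else _) => apply: recursive_if
  | H : computable1 ?f |- recursive _ (fun s => ?f _) => apply: (recursive_op1 H)
  | H : computable2 ?f |- recursive _ (fun s => ?f _ _) => apply: (recursive_op2 H)
  | H : computable3 ?f |- recursive _ (fun s => ?f _ _ _) => apply: (recursive_op3 H)
  end.
Ltac prove_recursive := repeat recursive_step.

Lemma computable_div : computable2 divn.
Proof.
rewrite -recursive_computable2.
(* On [[:: z; m; d]] this vanishes exactly when [d = 0] or [m < z.+1 * d]; the least such [z] is
   [m %/ d], also for [d = 0]. *)
pose F s := ((0 < nth 0 s 2) && ((nth 0 s 0).+1 * nth 0 s 2 <= nth 0 s 1) : nat).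
apply: (@recursive_min 2 F); first by rewrite /F; prove_recursive.
case=> [|m [|d []]] //= _; rewrite /F /=.
case: d => [|d] /=; first by rewrite divn0.
split=> [|z]; first by rewrite leqNgt ltn_ceil.
by rewrite leq_divRL // => ->.
Qed.

Lemma computable_mod : computable2 modn.
Proof.
rewrite -recursive_computable2.
have : recursive 2 (fun s => nth 0 s 0 - nth 0 s 0 %/ nth 0 s 1 * nth 0 s 1).
  by have cdiv := computable_div; prove_recursive.
by apply: recursive_ext => s _; rewrite {1}(divn_eq (nth 0 s 0) (nth 0 s 1)) addKn.
Qed.

(** * Decoding of [CodeSeq.code] and of pairings *)

(** One step of the fold [CodeSeq.code]: the code of [x :: s] is by conversion
    [cons_code x (CodeSeq.code s)], and the empty list has code 0. *)
Definition cons_code x y := 2 ^ x * y.*2.+1.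
Definition head_code z := logn 2 z.
Definition tail_code z := z %/ 2 ^ logn 2 z %/ 2.

Arguments cons_code : simpl never.
Arguments head_code : simpl never.
Arguments tail_code : simpl never.

Lemma head_cons_code x y : head_code (cons_code x y) = x.
Proof.
rewrite /head_code /cons_code lognM ?expn_gt0 // pfactorK // logn_coprime ?addn0 //.
by rewrite coprime2n /= odd_double.
Qed.

Lemma tail_cons_code x y : tail_code (cons_code x y) = y.
Proof.
rewrite /tail_code -/(head_code _) head_cons_code /cons_code mulKn ?expn_gt0 //.
by rewrite divn2 -[_.*2.+1]/(true + _) half_bit_double.
Qed.

Lemma cons_code_eq0 x y : (cons_code x y == 0) = false.
Proof. by rewrite /cons_code muln_eq0 expn_eq0. Qed.

Lemma computable_cons_code : computable2 cons_code.
Proof.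
rewrite -recursive_computable2.
have : recursive 2 (fun s => 2 ^ nth 0 s 0 * (nth 0 s 1 * 2).+1) by prove_recursive.
by apply: recursive_ext => s _; rewrite /cons_code muln2.
Qed.

Lemma computable_head_code : computable1 head_code.
Proof.
rewrite -recursive_computable1.
(* The search is for the least exponent whose successor power of 2 no longer divides the argument;
   the first conjunct makes it stop at once for the argument 0, where [logn 2 0 = 0]. *)
pose F s := (0 < nth 0 s 1) && (nth 0 s 1 %% 2 ^ (nth 0 s 0).+1 == 0) : nat.
apply: (@recursive_min 1 F).
  by have cmod := computable_mod; rewrite /F; prove_recursive.
case=> [|z []] //= _; rewrite /F /head_code.
rewrite /nth.
case: (posnP z) => [->|z_gt0]; first by rewrite logn0.
rewrite -[_ == 0]/(_ %| z) pfactor_dvdn // ltnn; split=> // y lty.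
by rewrite -[_ == 0]/(_ %| z) pfactor_dvdn // lty.
Qed.

Lemma computable_tail_code : computable1 tail_code.
Proof.
rewrite -recursive_computable1 /tail_code.
by have cdiv := computable_div; have chead := computable_head_code; prove_recursive.
Qed.

Definition drop_code z t := iter t tail_code z.

Lemma computable_drop_code : computable2 drop_code.
Proof.
rewrite -recursive_computable2 /drop_code.
have ctail := computable_tail_code.
by apply: (recursive_iter (G := fun s => tail_code (nth 0 s 0))); prove_recursive.
Qed.

Lemma drop_codeE s t : drop_code (CodeSeq.code s) t = CodeSeq.code (drop t s).
Proof.
elim: t s => [|t IH] s; first by rewrite drop0.
rewrite /drop_code iterSr -/(drop_code _ _).
case: s => [|x s]; last by rewrite tail_cons_code IH.
(* The tail of the code 0 is 0 again, so dropping past the end stays at the empty list. *)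
by rewrite -[tail_code _]/(CodeSeq.code [::]) IH; case: (t).
Qed.

Lemma code_eq0 s : (CodeSeq.code s == 0) = nilp s.
Proof. by case: s => // x s; apply: cons_code_eq0. Qed.

Definition nth_code z t := head_code (drop_code z t).

Lemma nth_codeE s t : nth_code (CodeSeq.code s) t = nth 0 s t.
Proof.
rewrite /nth_code drop_codeE; case: (ltnP t (size s)) => [lt_t|le_t].
  by rewrite (drop_nth 0) // head_cons_code.
by rewrite drop_oversize // nth_default.
Qed.

Lemma computable_nth_code : computable2 nth_code.
Proof.
rewrite -recursive_computable2.
rewrite /nth_code.
by have chead := computable_head_code; have cdrop := computable_drop_code; prove_recursive.
Qed.

(** Bijectivity of [pr] provides an inverse only as a function. It is computed by a search for a
    single number [u] that codes both components through [cons_code]. *)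
Lemma computable_unpairing pr : computable_pairing pr ->
  exists pr1 pr2, [/\ computable1 pr1, computable1 pr2,
    forall x y, pr1 (pr x y) = x, forall x y, pr2 (pr x y) = y &
    forall z, pr (pr1 z) (pr2 z) = z].
Proof.
move=> [cpr [g gK Kg] _].
pose P z u := pr (head_code u) (tail_code u) == z.
have exP z : exists u, P z u.
  exists (cons_code (g z).1 (g z).2).
  by rewrite /P head_cons_code tail_cons_code; apply/eqP/Kg.
pose G z := ex_minn (exP z).
have PG z : pr (head_code (G z)) (tail_code (G z)) = z.
  by rewrite /G; case: ex_minnP => u /eqP.
have chead := computable_head_code; have ctail := computable_tail_code.
have recG : computable1 G.
  rewrite -recursive_computable1.
  pose F s := ~~ P (nth 0 s 1) (nth 0 s 0) : nat.
  apply: (@recursive_min 1 F).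
    by rewrite /F /P; prove_recursive.
  case=> [|z []] //= _; rewrite /F /= /G; case: ex_minnP => u Pu minu.
  split=> [|v]; first by rewrite Pu.
  by case: (boolP (P z v)) => // /minu; rewrite leqNgt => /negbTE->.
have gG z : g z = (head_code (G z), tail_code (G z)).
  by rewrite -{1}(PG z) -[RHS]gK.
exists (fun z => head_code (G z)), (fun z => tail_code (G z)); split=> //.
- by rewrite -recursive_computable1; prove_recursive.
- by rewrite -recursive_computable1; prove_recursive.
- by move=> x y; have := gK (x, y); rewrite gG => -[].
- by move=> x y; have := gK (x, y); rewrite gG => -[].
Qed.

(** * Simulation of Turing programs *)

Section Simulation.

Variable Sigma : alphabet.

(* A half-tape is read as a number in base #|Sigma| + 1 in which the blank is
   the digit 0, so that the blank cells beyond the list need no special case. *)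
Definition base := #|Sigma|.+1.

Definition rank_digit r :=
  if r == nat_of_ord (enum_rank (blank Sigma)) then 0 else r.+1.

Definition digit (s : Sigma) := rank_digit (enum_rank s).

Lemma digit_inj : injective digit.
Proof.
move=> s s'; rewrite /digit /rank_digit.
do 2?[case: eqP => [/ord_inj/enum_rank_inj->|_]] => //.
by move=> [/ord_inj/enum_rank_inj].
Qed.

Lemma digit_blank : digit (blank Sigma) = 0.
Proof. by rewrite /digit /rank_digit eqxx. Qed.

Lemma digit_lt s : digit s < base.
Proof. by rewrite /digit /rank_digit; case: ifP => // _; rewrite ltnS ltn_ord. Qed.

Definition tape_code (l : seq Sigma) := foldr (fun s m => digit s + m * base) 0 l.

Lemma tape_code_mod l : tape_code l %% base = digit (head (blank Sigma) l).
Proof.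
case: l => [|s l]; first by rewrite mod0n digit_blank.
by rewrite /= addnC modnMDl modn_small ?digit_lt.
Qed.

Lemma tape_code_div l : tape_code l %/ base = tape_code (behead l).
Proof.
by case: l => [|s l]; rewrite ?div0n //= addnC divnMDl // divn_small ?digit_lt ?addn0.
Qed.

Definition config_code (c : config Sigma) :=
  cons_code (cstate c) (cons_code (tape_code (ltape c)) (tape_code (rtape c))).

Definition state_of c := head_code c.
Definition left_of c := head_code (tail_code c).
Definition right_of c := tail_code (tail_code c).

Definition matches q a ic := (nth_code ic 0 == q) && (rank_digit (nth_code ic 1) == a).
Definition matching_index p q a := find (matches q a) (CodeSeq.decode p).
(** For the code of a program this is the code of its part from the first applicable instruction on:
    0 if no instruction applies, and otherwise a number whose head is the code of the instruction to
    be executed. *)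
Definition matching_suffix p c :=
  drop_code p (matching_index p (state_of c) (right_of c %% base)).

Definition halted_code p c := matching_suffix p c == 0.

Definition step_code p c :=
  let ic := head_code (matching_suffix p c) in
  let r := rank_digit (nth_code ic 2) + right_of c %/ base * base in
  if halted_code p c then c else
  cons_code (nth_code ic 4)
    (if nth_code ic 3 == 0 then
       cons_code (left_of c %/ base) (left_of c %% base + r * base)
     else if nth_code ic 3 == 1 then cons_code (left_of c) r
     else cons_code (rank_digit (nth_code ic 2) + left_of c * base)
                    (right_of c %/ base)).

Lemma computable_rank_digit : computable1 rank_digit.
Proof. by rewrite -recursive_computable1 /rank_digit; prove_recursive. Qed.

Ltac recursive_code_step :=
  match goal with
  | |- recursive _ (fun s => divn _ _) => apply: (recursive_op2 computable_div)
  | |- recursive _ (fun s => modn _ _) => apply: (recursive_op2 computable_mod)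
  | |- recursive _ (fun s => rank_digit _) => apply: (recursive_op1 computable_rank_digit)
  | |- recursive _ (fun s => head_code _) => apply: (recursive_op1 computable_head_code)
  | |- recursive _ (fun s => tail_code _) => apply: (recursive_op1 computable_tail_code)
  | |- recursive _ (fun s => cons_code _ _) => apply: (recursive_op2 computable_cons_code)
  | |- recursive _ (fun s => drop_code _ _) => apply: (recursive_op2 computable_drop_code)
  | |- recursive _ (fun s => nth_code _ _) => apply: (recursive_op2 computable_nth_code)
  end.
Ltac prove_recursive_code := repeat (recursive_step || recursive_code_step).

Lemma computable_matching_index : computable3 matching_index.
Proof.
(* The first disjunct ends the search at the end of the list, where [find] returns the size if
   nothing matches. *)
pose F s := ~~ ((drop_code (nth 0 s 1) (nth 0 s 0) == 0) ||
  matches (nth 0 s 2) (nth 0 s 3) (nth_code (nth 0 s 1) (nth 0 s 0))) : nat.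
apply: (@recursive_min 3 F); first by rewrite /F /matches; prove_recursive_code.
case=> [|p [|q [|a []]]] // _.
rewrite /F /matching_index -[p]CodeSeq.decodeK; move: (CodeSeq.decode p) => l.
rewrite /nth CodeSeq.codeK.
split=> [|t].
  rewrite drop_codeE nth_codeE code_eq0 /nilp size_drop.
  by case: findP => [_|i lt_i m _]; rewrite ?subnn // m orbT.
move=> lt_t; rewrite drop_codeE nth_codeE code_eq0 /nilp size_drop.
rewrite (before_find 0 lt_t) orbF subn_eq0 -ltnNge.
by rewrite (leq_trans lt_t) ?find_size.
Qed.

Lemma computable_matching_suffix : computable2 matching_suffix.
Proof.
rewrite -recursive_computable2 /matching_suffix /state_of /right_of.
by have cindex := computable_matching_index; prove_recursive_code.
Qed.

Lemma recursive_halted_code n F G : recursive n F -> recursive n G ->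
  recursive n (fun s => halted_code (F s) (G s)).
Proof.
move=> recF recG; rewrite /halted_code.
by have csuffix := computable_matching_suffix; prove_recursive.
Qed.

Lemma computable_step_code : computable2 step_code.
Proof.
rewrite -recursive_computable2 /step_code /left_of /right_of.
have recN := recursive_op2 computable_matching_suffix (@recursive_nth 2 0 isT)
  (@recursive_nth 2 1 isT).
have recH := recursive_halted_code (@recursive_nth 2 0 isT) (@recursive_nth 2 1 isT).
by prove_recursive_code.
Qed.

Lemma matches_code q s (c : instruction Sigma) :
  matches q (digit s) (instruction_code c) = (in_state c == q) && (scanned c == s).
Proof.
rewrite /matches /instruction_code !nth_codeE /=.
by rewrite -/(digit (scanned c)) (inj_eq digit_inj).
Qed.

Lemma lookup_code (P : program Sigma) (c : config Sigma) :
  let s := drop (matching_index (program_code P) (cstate c) (digit (head_symbol c))) P in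
  matching_suffix (program_code P) (config_code c) = program_code s /\
  lookup P (cstate c) (head_symbol c) =
    if s is i :: _ then Some (written i, direction i, out_state i) else None.
Proof.
rewrite /matching_suffix /state_of /right_of head_cons_code !tail_cons_code.
rewrite tape_code_mod /program_code drop_codeE map_drop; split=> //.
rewrite -/(head_symbol c) /matching_index CodeSeq.codeK find_map.
elim: P => //= i P IH; rewrite matches_code.
by case: ifP => //= _; rewrite IH.
Qed.

Lemma halted_codeE (P : program Sigma) c :
  halted_code (program_code P) (config_code c) = halted P c.
Proof.
have [/= sufE lookE] := lookup_code P c; rewrite /halted_code /halted sufE lookE.
by rewrite code_eq0 /nilp size_map; case: drop.
Qed.

Lemma step_codeE (P : program Sigma) c :
  step_code (program_code P) (config_code c) = config_code (step P c).
Proof.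
have [/= sufE lookE] := lookup_code P c; rewrite /step_code halted_codeE /step.
rewrite /halted sufE {}lookE; case: (drop _ _) {sufE} => [|i s]; first by [].
rewrite -[program_code (i :: s)]/(cons_code (instruction_code i) (program_code s)).
rewrite head_cons_code /instruction_code !nth_codeE [nth _ _ _]/= [nth _ _ _]/=.
rewrite [nth _ _ _]/= -/(digit (written i)) /left_of /right_of.
rewrite !tail_cons_code head_cons_code !(tape_code_mod, tape_code_div) /config_code.
by case: (direction i).
Qed.

Definition run_code p c j := iter j (step_code p) c.

Lemma computable_run_code : computable3 run_code.
Proof.
rewrite /computable3 /run_code.
have cstep := computable_step_code.
by apply: (recursive_iter (G := fun s => step_code (nth 0 s 1) (nth 0 s 0))); prove_recursive.
Qed.

Lemma run_codeE (P : program Sigma) c j :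
  run_code (program_code P) (config_code c) j = config_code (iter j (step P) c).
Proof. by rewrite /run_code; elim: j => //= j ->; rewrite step_codeE. Qed.

(** * Counting of strokes; codes of outputs and inputs *)

Definition count_strokes m k :=
  iteri k (fun i w => w + (m %/ base ^ i %% base == digit (stroke Sigma))) 0.

Lemma computable_count_strokes : computable2 count_strokes.
Proof.
rewrite -recursive_computable2.
pose G s := nth 0 s 1 + (nth 0 s 2 %/ base ^ (nth 0 s 0) %% base == digit (stroke Sigma)).
have recG : recursive 4 G by rewrite /G; prove_recursive_code.
have := recursive_rec (recursive_const 2 0) recG (@recursive_nth 2 1 isT).
by apply: recursive_ext => s _; rewrite /count_strokes; elim: (nth 0 s 1) => //= k ->.
Qed.

Lemma digit_stroke_neq0 : digit (stroke Sigma) != 0.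
Proof. by rewrite -digit_blank (inj_eq digit_inj) eq_sym blank_neq_stroke. Qed.

Lemma count_strokes_code (l : seq Sigma) k : size l <= k ->
  count_strokes (tape_code l) k = count_mem (stroke Sigma) l.
Proof.
elim: l k => [|s l IH] k le_k.
  rewrite /count_strokes; elim: k {le_k} => //= k ->.
  by rewrite div0n mod0n eq_sym (negbTE digit_stroke_neq0).
case: k le_k => // k le_k; rewrite [RHS]/= -(IH k) //.
have := tape_code_div (s :: l); have := tape_code_mod (s :: l).
move: (tape_code (s :: l)) => m /= modE divE.
rewrite /count_strokes; elim: k {le_k IH} => [|k IHk].
  by rewrite /= expn0 divn1 modE (inj_eq digit_inj) addn0.
rewrite iteriS {}IHk /= -addnA; congr (_ + (_ + (_ == _))).
by rewrite expnS divnMA divE.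
Qed.

Lemma base_gt1 : 1 < base.
Proof. by rewrite ltnS; apply/card_gt0P; exists (blank Sigma). Qed.

(** Trailing blanks leave no trace in the code, so the length of the list cannot be read off. The
    code [m] itself bounds the number of digits, because [m < base ^ m]; the digits beyond are 0,
    which is not the digit of a stroke. *)
Lemma count_strokes_code_self (l : seq Sigma) :
  count_strokes (tape_code l) (tape_code l) = count_mem (stroke Sigma) l.
Proof.
rewrite -(@count_strokes_code l (size l + tape_code l)) ?leq_addr //.
move: (tape_code l) => m; elim: (size l) => //= k ->.
rewrite divn_small ?mod0n 1?eq_sym ?(negbTE digit_stroke_neq0) ?addn0 //.
by rewrite (leq_trans (ltn_expl m base_gt1)) // leq_exp2l ?base_gt1 // leq_addl.
Qed.

Definition output_code c :=
  count_strokes (left_of c) (left_of c) + count_strokes (right_of c) (right_of c).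

Lemma computable_output_code : computable1 output_code.
Proof.
rewrite -recursive_computable1 /output_code /left_of /right_of.
by have ccount := computable_count_strokes; prove_recursive_code.
Qed.

Lemma output_codeE (c : config Sigma) : output_code (config_code c) = output c.
Proof.
rewrite /output_code /left_of /right_of !tail_cons_code head_cons_code.
by rewrite !count_strokes_code_self.
Qed.

Definition block_code v w := iter v.+1 (fun m => digit (stroke Sigma) + m * base) (w * base).

Lemma computable_block_code : computable2 block_code.
Proof.
rewrite -recursive_computable2 /block_code.
apply: (recursive_iter (G := fun s => digit (stroke Sigma) + nth 0 s 0 * base));
  by prove_recursive.
Qed.

Lemma block_codeE v l : block_code v (tape_code l) =
  tape_code (nseq v.+1 (stroke Sigma) ++ blank Sigma :: l).
Proof.
rewrite /block_code; elim: v.+1 => [|k] /=; first by rewrite digit_blank.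
by rewrite /tape_code => ->.
Qed.

Definition input_code x := cons_code 0 (cons_code 0 (foldr block_code 0 x)).

Lemma input_codeE x : input_code x = config_code (Config 0 [::] (input_tape Sigma x)).
Proof.
rewrite /input_code /config_code /=; do 2 congr cons_code.
elim: x => [|v x IH] //; rewrite [foldr _ _ _]/= IH block_codeE; congr tape_code.
by rewrite [RHS]/input_tape [flatten _]/= -cats1 -catA.
Qed.

Lemma recursive_input_code n : recursive n input_code.
Proof.
have rec_foldr k : k <= n -> recursive n (fun s => foldr block_code 0 (drop (n - k) s)).
  elim: k => [|k IH] lt_k.
    apply: (recursive_ext _ (recursive_const n 0)) => s sn.
    by rewrite drop_oversize ?sn ?subn0.
  have rec_nth : recursive n (fun s => nth 0 s (n - k.+1)).
    by apply: recursive_nth; rewrite ltn_subrL (leq_trans _ lt_k).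
  apply: recursive_ext (recursive_op2 computable_block_code rec_nth (IH (ltnW lt_k))).
  move=> s sn; rewrite [in RHS](drop_nth 0) ?sn ?ltn_subrL ?(leq_trans _ lt_k) //=.
  by rewrite -subSn // subSS.
rewrite /input_code; prove_recursive_code.
by apply: recursive_ext (rec_foldr n (leqnn n)) => s _; rewrite subnn drop0.
Qed.

Definition run_input_code p x j := run_code p (input_code x) j.

Lemma run_input_codeE (P : program Sigma) x j :
  run_input_code (program_code P) x j = config_code (run P x j).
Proof. by rewrite /run_input_code input_codeE run_codeE. Qed.

End Simulation.

(** * A stack language and its translation into Turing programs *)

(** A stack entry is one block of strokes on the tape, the top being the leftmost block. [Push]
    pushes 0; [Inc i], [Dec i] and the test of [While i] refer to the [i]-th entry below the top. *)
Inductive command :=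
  | Skip | Push | Pop | Inc of nat | Dec of nat
  | Seq of command & command | While of nat & command.

Section Compilation.

Variable Sigma : alphabet.
Let B := blank Sigma.
Let I := stroke Sigma.
Implicit Types (P Q : program Sigma) (c : command) (L R S T U : seq nat).
Implicit Types (s t v w i k : nat).

(** Every fragment starts in its first state [s] and is left by entering the first state after its
    own ones, so that fragments are composed by concatenation. *)
Fixpoint moves_right i s : program Sigma :=
  if i is i'.+1 then
    [:: Instruction s I I Rgt s; Instruction s B B Rgt s.+1] ++ moves_right i' s.+1
  else [::].

Fixpoint moves_left i s : program Sigma :=
  if i is i'.+1 then
    [:: Instruction s I I Lft s.+1; Instruction s.+1 B B Lft s.+2;
        Instruction s.+2 I I Lft s.+2; Instruction s.+2 B B Rgt s.+3]
    ++ moves_left i' s.+3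
  else [::].

(* The head is on the blank to the left of a block that has to grow by one
   stroke to the left; each of the [i] blocks further left is then shifted by
   one cell to the left. *)
Fixpoint shifts_left i s : program Sigma :=
  if i is i'.+1 then
    [:: Instruction s I I Lft s; Instruction s B I Lft s.+1;
        Instruction s.+1 I B Lft s.+2] ++ shifts_left i' s.+2
  else [:: Instruction s I I Lft s; Instruction s B I Stay s.+1].

(* The head is on the first stroke of a block that has to lose one stroke; the
   [i] blocks to its left are shifted by one cell to the right. *)
Fixpoint shifts_right i s : program Sigma :=
  if i is i'.+1 then
    [:: Instruction s I B Lft s.+1; Instruction s.+1 B I Lft s.+2;
        Instruction s.+2 I I Lft s.+2; Instruction s.+2 B B Rgt s.+3]
    ++ shifts_right i' s.+3
  else [:: Instruction s I B Rgt s.+1].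

Fixpoint states_of c : nat :=
  match c with
  | Skip => 0
  | Push => 3
  | Pop => 1
  | Inc i => i + (1 + (2 * i + 1))
  | Dec i => i + (3 * i + 1)
  | Seq c1 c2 => states_of c1 + states_of c2
  | While i c => i + (2 + (3 * i + (states_of c + (1 + 3 * i))))
  end.

(** A value [v] occupies [v.+1] strokes, so the test of [While] looks for a second stroke. The body
    starts in state [b] and ends in state [g], from which the program jumps back to [s]; this jump
    scans a stroke and so needs a nonempty stack. The exit branch has its own return to the leftmost
    block. *)
Fixpoint compile c s : program Sigma :=
  match c with
  | Skip => [::]
  | Push => [:: Instruction s I I Lft s.+1; Instruction s.+1 B B Lft s.+2;
                Instruction s.+2 B I Stay s.+3]
  | Pop => [:: Instruction s I B Rgt s; Instruction s B B Rgt s.+1]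
  | Inc i => moves_right i s
      ++ Instruction (s + i) I I Lft (s + i).+1 :: shifts_left i (s + i).+1
  | Dec i => moves_right i s ++ shifts_right i (s + i)
  | Seq c1 c2 => compile c1 s ++ compile c2 (s + states_of c1)
  | While i c =>
      let t := s + i in
      let b := t.+2 + 3 * i in
      let g := b + states_of c in
      moves_right i s
      ++ [:: Instruction t I I Rgt t.+1; Instruction t.+1 I I Lft t.+2;
             Instruction t.+1 B B Lft g.+1]
      ++ moves_left i t.+2 ++ compile c b
      ++ Instruction g I I Stay s :: moves_left i g.+1
  end.

(** Phrased by [lookup], so that it expresses that no instruction of the fragment is shadowed by an
    earlier one of the surrounding program. *)
Fixpoint implements Q P : Prop :=
  if P is i :: P' then
    lookup Q (in_state i) (scanned i) = Some (written i, direction i, out_state i)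
    /\ implements Q P'
  else True.

Lemma implements_cat Q P1 P2 :
  implements Q (P1 ++ P2) <-> implements Q P1 /\ implements Q P2.
Proof. by elim: P1 => /= [|i P1 [IH1 IH2]]; intuition. Qed.

(** * Runs of compiled commands on tapes of blocks *)

Definition reach Q (x y : config Sigma) := exists k, iter k (step Q) x = y.

Lemma reach_refl Q x : reach Q x x.
Proof. by exists 0. Qed.

Lemma reach_trans Q x y z : reach Q x y -> reach Q y z -> reach Q x z.
Proof. by move=> [k <-] [k' <-]; exists (k' + k); rewrite iterD. Qed.

Lemma reach_step Q x y : reach Q (step Q x) y -> reach Q x y.
Proof. by apply: reach_trans; exists 1. Qed.

Lemma step_right Q q l a r b q' : lookup Q q a = Some (b, Rgt, q') ->
  step Q (Config q l (a :: r)) = Config q' (b :: l) r.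
Proof. by rewrite /step /head_symbol /= => ->. Qed.

Lemma step_left Q q l a r b q' : lookup Q q a = Some (b, Lft, q') ->
  step Q (Config q l (a :: r)) = Config q' (behead l) (head B l :: b :: r).
Proof. by rewrite /step /head_symbol /= => ->. Qed.

Lemma step_stay Q q l a r b q' : lookup Q q a = Some (b, Stay, q') ->
  step Q (Config q l (a :: r)) = Config q' l (b :: r).
Proof. by rewrite /step /head_symbol /= => ->. Qed.

Lemma nseq_cat_cons (a : Sigma) k r : nseq k a ++ a :: r = a :: nseq k a ++ r.
Proof. by elim: k => //= k ->. Qed.

Lemma scan_right Q q k l r : lookup Q q I = Some (I, Rgt, q) ->
  reach Q (Config q l (nseq k I ++ r)) (Config q (nseq k I ++ l) r).
Proof.
move=> Qq; elim: k l => [|k IH] l; first exact: reach_refl.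
by apply: reach_step; rewrite (step_right _ _ Qq) /= -nseq_cat_cons; apply: IH.
Qed.

(** The initial configuration has the form that a step to the left produces when the cells to the
    left may be exhausted. *)
Lemma scan_left Q q k l r : lookup Q q I = Some (I, Lft, q) -> head B l = B ->
  reach Q (Config q (behead (nseq k I ++ l)) (head B (nseq k I ++ l) :: r))
          (Config q (behead l) (B :: nseq k I ++ r)).
Proof.
move=> Qq lB; elim: k r => [|k IH] r; first by rewrite /= lB; apply: reach_refl.
by apply: reach_step; rewrite (step_left _ _ Qq) /= -nseq_cat_cons; apply: IH.
Qed.

(** Lists of cells are not normalised: a run may leave any number [k] of explicit blanks on the far
    left, and this number changes from command to command. *)
Definition left_tape L k := flatten [seq B :: nseq v.+1 I | v <- L] ++ nseq k B.

Lemma head_left_tape L k : head B (left_tape L k) = B.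
Proof. by case: L k => [|v L] [|k]. Qed.

Lemma behead_left_tape L k :
  exists k', B :: behead (left_tape L k) = left_tape L k'.
Proof.
case: L k => [|v L] [|k].
- by exists 1.
- by exists k.+1.
- by exists 0.
- by exists k.+1.
Qed.

Lemma left_tape_cons v L k :
  left_tape (v :: L) k = B :: I :: nseq v I ++ left_tape L k.
Proof. by rewrite /left_tape /= -catA. Qed.

Lemma input_tape_cons v R :
  input_tape Sigma (v :: R) = I :: nseq v I ++ B :: input_tape Sigma R.
Proof. by rewrite /input_tape /= -cats1 -catA. Qed.

(* [leads Q s L R s' L' R']: from state [s] with the head on the first stroke of
   the blocks [R] and with the blocks [L], nearest first, to the left of it. *)
Definition leads Q s L R s' L' R' := forall k, exists k',
  reach Q (Config s (left_tape L k) (input_tape Sigma R))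
          (Config s' (left_tape L' k') (input_tape Sigma R')).

Lemma leads_refl Q s L R : leads Q s L R s L R.
Proof. by move=> k; exists k; apply: reach_refl. Qed.

Lemma leads_trans Q s1 L1 R1 s2 L2 R2 s3 L3 R3 :
  leads Q s1 L1 R1 s2 L2 R2 -> leads Q s2 L2 R2 s3 L3 R3 -> leads Q s1 L1 R1 s3 L3 R3.
Proof.
move=> l12 l23 k; have [k2 r12] := l12 k; have [k3 r23] := l23 k2.
by exists k3; apply: reach_trans r12 r23.
Qed.

Lemma leads_moves_right Q s L T v U : implements Q (moves_right (size T) s) ->
  leads Q s L (T ++ v :: U) (s + size T) (catrev T L) (v :: U).
Proof.
elim: T s L => [|a T IH] s L /=; first by rewrite addn0 => _; apply: leads_refl.
move=> [QI [QB /IH]]; rewrite -addSnnS => /(_ (a :: L)); apply: leads_trans => k.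
exists k; rewrite input_tape_cons left_tape_cons -cat_cons.
apply: reach_trans (scan_right a.+1 _ _ QI) _.
by apply: reach_step; rewrite (step_right _ _ QB); apply: reach_refl.
Qed.

Lemma leads_moves_left Q s L v U : implements Q (moves_left (size L) s) ->
  leads Q s L (v :: U) (s + 3 * size L) [::] (catrev L (v :: U)).
Proof.
elim: L s v U => [|a L IH] s v U /=; first by rewrite muln0 addn0 => _; apply: leads_refl.
move=> [Q0 [Q1 [Q2 [Q3 /IH]]]].
rewrite (_ : s.+3 + _ = s + 3 * (size L).+1); last by lia.
move=> /(_ a (v :: U)); apply: leads_trans => k.
have [k' lE] := behead_left_tape L k; exists k'.
rewrite left_tape_cons (input_tape_cons a) input_tape_cons.
apply: reach_step; rewrite (step_left _ _ Q0) /=.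
apply: reach_step; rewrite (step_left _ _ Q1) /=.
apply: reach_trans (scan_left a.+1 _ Q2 (head_left_tape L k)) _.
by apply: reach_step; rewrite (step_right _ _ Q3) lE; apply: reach_refl.
Qed.

Lemma leads_back Q s T v U : implements Q (moves_left (size T) s) ->
  leads Q s (rev T) (v :: U) (s + 3 * size T) [::] (T ++ v :: U).
Proof.
by rewrite -(size_rev T) => /leads_moves_left-/(_ v U); rewrite catrevE revK size_rev.
Qed.

(** The current block has [w] strokes from the head to the left and [v] to its right, and gains one.
    A block further left first gives up its rightmost stroke to the separating blank and then
    regains one on its left, hence the call with [v = 0] in the induction. *)
Lemma reach_shifts_left Q s L k w v U : implements Q (shifts_left (size L) s) ->
  exists k', reach Q
    (Config s (behead (nseq w I ++ left_tape L k))
              (head B (nseq w I ++ left_tape L k) :: nseq v I ++ B :: input_tape Sigma U))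
    (Config (s + (2 * size L + 1)) (left_tape [::] k')
            (input_tape Sigma (catrev L (w + v :: U)))).
Proof.
elim: L s k w v U => [|a L IH] s k w v U /=.
  rewrite muln0 add0n addn1 => -[QI [QB _]].
  exists k.-1; apply: reach_trans (scan_left _ _ QI (head_left_tape _ _)) _.
  apply: reach_step; rewrite (step_stay _ _ QB) input_tape_cons.
  by rewrite nseqD -catA /left_tape; case: k => [|k]; apply: reach_refl.
move=> [QI [QB [Q1 /IH IHs]]].
have [k' r] := IHs k a 0 (w + v :: U); exists k'; move: r.
rewrite (_ : s.+2 + _ = s + (2 * (size L).+1 + 1)); last by lia.
rewrite addn0; apply: reach_trans.
apply: reach_trans (scan_left _ _ QI (head_left_tape _ _)) _.
rewrite left_tape_cons.
apply: reach_step; rewrite (step_left _ _ QB) /=.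
apply: reach_step; rewrite (step_left _ _ Q1).
by rewrite input_tape_cons nseqD -catA; apply: reach_refl.
Qed.

(** The erased stroke becomes the new separator and the old separator a stroke of the next block to
    the left, which then has one stroke too many itself. *)
Lemma leads_shifts_right Q s L v U : implements Q (shifts_right (size L) s) ->
  leads Q s L (v.+1 :: U) (s + (3 * size L + 1)) [::] (catrev L (v :: U)).
Proof.
elim: L s v U => [|a L IH] s v U /=.
  rewrite muln0 add0n addn1 => -[Q0 _] k; exists k.+1.
  rewrite !input_tape_cons; apply: reach_step.
  by rewrite (step_right _ _ Q0); apply: reach_refl.
move=> [Q0 [Q1 [Q2 [Q3 /IH]]]].
rewrite (_ : s.+3 + _ = s + (3 * (size L).+1 + 1)); last by lia.
move=> /(_ a (v :: U)); apply: leads_trans => k.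
have [k' lE] := behead_left_tape L k; exists k'.
rewrite left_tape_cons (input_tape_cons a.+1) !input_tape_cons.
apply: reach_step; rewrite (step_left _ _ Q0) /=.
apply: reach_step; rewrite (step_left _ _ Q1) /=.
apply: reach_trans (scan_left a.+1 _ Q2 (head_left_tape L k)) _.
apply: reach_step; rewrite (step_right _ _ Q3) lE /= nseq_cat_cons.
exact: reach_refl.
Qed.

(** Correctness on one given stack, wherever the code is placed; commands that loop forever are not
    described. *)
Definition does c S S' := forall Q s,
  implements Q (compile c s) -> leads Q s [::] S (s + states_of c) [::] S'.

Lemma does_skip S : does Skip S S.
Proof. by move=> Q s _; rewrite addn0; apply: leads_refl. Qed.

Lemma does_push v S : does Push (v :: S) [:: 0, v & S].
Proof.
(* Two blanks turn into the separator and the new block; truncated subtraction covers tapes with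
   fewer explicit blanks. *)
move=> Q s /= [Q0 [Q1 [Q2 _]]] k; exists k.-2.
rewrite !input_tape_cons addn3.
apply: reach_step; rewrite (step_left _ _ Q0) head_left_tape.
apply: reach_step; rewrite (step_left _ _ Q1).
have -> : head B (behead (left_tape [::] k)) = B by case: k => [|[|k]].
apply: reach_step; rewrite (step_stay _ _ Q2).
by case: k => [|[|k]]; apply: reach_refl.
Qed.

Lemma does_pop v S : does Pop (v :: S) S.
Proof.
move=> Q s /= [QI [QB _]] k; rewrite addn1 input_tape_cons.
have erase j l r : reach Q (Config s l (nseq j I ++ r)) (Config s (nseq j B ++ l) r).
  elim: j l => [|j IH] l; first exact: reach_refl.
  by apply: reach_step; rewrite (step_right _ _ QI) /= -nseq_cat_cons; apply: IH.
exists (v.+2 + k).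
apply: reach_trans (erase v.+1 _ _) _.
apply: reach_step; rewrite (step_right _ _ QB).
by rewrite /left_tape /= nseqD; apply: reach_refl.
Qed.

Lemma does_inc T v U : does (Inc (size T)) (T ++ v :: U) (T ++ v.+1 :: U).
Proof.
move=> Q s /= /implements_cat[/leads_moves_right-/(_ [::] v U) right [Q0 Qshift]].
apply: leads_trans right _ => k.
rewrite input_tape_cons.
have szT : size T = size (rev T) by rewrite size_rev.
rewrite szT in Qshift.
have [k' r] := reach_shifts_left k 0 v.+1 U Qshift; exists k'.
apply: reach_step; rewrite (step_left _ _ Q0).
move: r; rewrite size_rev [catrev (rev T) _]catrevE revK.
by rewrite -/(rev T) (_ : (_).+1 + _ = s + (size T + (1 + (2 * size T + 1)))) //; lia.
Qed.

Lemma does_dec T v U : does (Dec (size T)) (T ++ v.+1 :: U) (T ++ v :: U).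
Proof.
move=> Q s /= /implements_cat[/leads_moves_right-/(_ [::] v.+1 U) right Qshift].
apply: leads_trans right _; rewrite -/(rev T).
have szT : size T = size (rev T) by rewrite size_rev.
rewrite szT in Qshift.
have := leads_shifts_right v U Qshift.
by rewrite size_rev catrevE revK -addnA.
Qed.

Lemma does_seq c1 c2 S1 S2 S3 :
  does c1 S1 S2 -> does c2 S2 S3 -> does (Seq c1 c2) S1 S3.
Proof.
move=> d1 d2 Q s /= /implements_cat[/d1 l1 /d2 l2]; rewrite addnA.
exact: leads_trans l1 l2.
Qed.

Lemma does_while0 T U c : does (While (size T) c) (T ++ 0 :: U) (T ++ 0 :: U).
Proof.
move=> Q s /= /implements_cat[/leads_moves_right-/(_ [::] 0 U) right].
move=> /= [Q0 [_ [Q1]]] /implements_cat[_ /implements_cat[_ [_ left]]].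
apply: leads_trans right _; rewrite -/(rev T).
have := leads_back 0 U left.
rewrite (_ : (_ + states_of c).+1 + 3 * _ = s + states_of (While (size T) c));
  last by rewrite /=; lia.
apply: leads_trans => k; exists k.
rewrite input_tape_cons.
apply: reach_step; rewrite (step_right _ _ Q0).
by apply: reach_step; rewrite (step_left _ _ Q1); apply: reach_refl.
Qed.

Lemma leads_while_body Q s T v U c : implements Q (compile (While (size T) c) s) ->
  leads Q s [::] (T ++ v.+1 :: U) ((s + size T).+2 + 3 * size T) [::] (T ++ v.+1 :: U).
Proof.
move=> /= /implements_cat[/leads_moves_right-/(_ [::] v.+1 U) right].
move=> /= [Q0 [Q1 [_]]] /implements_cat[left _].
apply: leads_trans right _; rewrite -/(rev T).
have := leads_back v.+1 U left.
apply: leads_trans => k; exists k.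
rewrite input_tape_cons.
apply: reach_step; rewrite (step_right _ _ Q0).
by apply: reach_step; rewrite (step_left _ _ Q1); apply: reach_refl.
Qed.

Lemma leads_while_iteration Q s T v U c w S :
  implements Q (compile (While (size T) c) s) ->
  does c (T ++ v.+1 :: U) (w :: S) -> leads Q s [::] (T ++ v.+1 :: U) s [::] (w :: S).
Proof.
move=> Qc dc; apply: leads_trans (leads_while_body v U Qc) _.
move: Qc => /= /implements_cat[_] /= [_ [_ [_]]].
move=> /implements_cat[_ /implements_cat[/dc body [Qg _]]].
apply: leads_trans body _ => k; exists k; rewrite input_tape_cons.
by apply: reach_step; rewrite (step_stay _ _ Qg); apply: reach_refl.
Qed.

Lemma does_whileS T v U c w S S' : does c (T ++ v.+1 :: U) (w :: S) ->
  does (While (size T) c) (w :: S) S' -> does (While (size T) c) (T ++ v.+1 :: U) S'.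
Proof.
move=> dc dw Q s Qc; apply: leads_trans (dw Q s Qc).
exact: leads_while_iteration Qc dc.
Qed.

End Compilation.

Arguments does_skip {Sigma} S.
Arguments does_push {Sigma} v S.
Arguments does_pop {Sigma} v S.
Arguments does_inc {Sigma} T v U.
Arguments does_dec {Sigma} T v U.
Arguments does_seq {Sigma c1 c2 S1} S2 {S3}.
Arguments does_while0 {Sigma} T U c.
Arguments does_whileS {Sigma} T {v U c w S S'}.

(** * Absence of clashes between the instructions of compiled programs *)

Section Determinism.

Variable Sigma : alphabet.
Let B := blank Sigma.
Let I := stroke Sigma.
Implicit Types (P Q : program Sigma).

Definition keys P := [seq (in_state i, scanned i) | i <- P].

Definition laid_out P a b :=
  [&& a <= b, uniq (keys P) & all (fun k => a <= k.1 < b) (keys P)].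

Lemma implements_cons Q P i :
  (in_state i, scanned i) \notin keys P ->
  implements Q P -> implements (i :: Q) P.
Proof.
elim: P => //= j P IH; rewrite inE negb_or xpair_eqE => /andP[ij iP] [Qj QP].
by rewrite (negbTE ij); split=> //; apply: IH.
Qed.

(** As no two instructions share state and scanned symbol, the first match found by [lookup] is the
    only one. The bounds on the states serve to carry this through concatenations. *)
Lemma laid_out_implements P a b : laid_out P a b -> implements P P.
Proof.
case/and3P => _ + _; elim: P => //= i P IH /andP[iP /IH PP].
by rewrite !eqxx; split=> //; apply: implements_cons.
Qed.

Lemma laid_out_nil a : laid_out [::] a a.
Proof. by rewrite /laid_out leqnn. Qed.

Lemma laid_out_cat P1 P2 a m b :
  laid_out P1 a m -> laid_out P2 m b -> laid_out (P1 ++ P2) a b.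
Proof.
move=> /and3P[am u1 s1] /and3P[mb u2 s2]; apply/and3P; split.
- exact: leq_trans am mb.
- rewrite /keys map_cat cat_uniq -/(keys P1) -/(keys P2) u1 u2 andbT /=.
  apply/hasPn => k kP2; apply/negP => kP1.
  by move/allP: s1 => /(_ k kP1); move/allP: s2 => /(_ k kP2); lia.
- rewrite /keys map_cat all_cat; apply/andP; split.
    by apply: sub_all s1 => i /andP[-> /leq_trans->].
  by apply: sub_all s2 => i /andP[+ ->]; rewrite andbT; apply: leq_trans.
Qed.

Lemma laid_out_cons P s a w d q b :
  laid_out P s.+1 b -> laid_out (Instruction s a w d q :: P) s b.
Proof.
have l1 : laid_out [:: Instruction s a w d q] s s.+1.
  by rewrite /laid_out /= leqnn ltnSn leqnSn.
exact: (laid_out_cat l1).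
Qed.

Lemma laid_out_cons2 P s w d q w' d' q' b :
  laid_out P s.+1 b ->
  laid_out (Instruction s I w d q :: Instruction s B w' d' q' :: P) s b.
Proof.
apply: (@laid_out_cat [:: Instruction s I w d q; Instruction s B w' d' q']).
rewrite /laid_out /= leqnn ltnSn leqnSn inE xpair_eqE eqxx eq_sym.
by rewrite (negbTE (blank_neq_stroke _)).
Qed.

Lemma laid_out_moves_right i s : laid_out (moves_right Sigma i s) s (s + i).
Proof.
elim: i s => [|i IH] s; first by rewrite addn0; apply: laid_out_nil.
by apply: laid_out_cons2; rewrite -addSnnS.
Qed.

Lemma laid_out_moves_left i s : laid_out (moves_left Sigma i s) s (s + 3 * i).
Proof.
elim: i s => [|i IH] s; first by rewrite addn0; apply: laid_out_nil.
do 2 apply: laid_out_cons; apply: laid_out_cons2.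
by rewrite mulnS addnA addn3.
Qed.

Lemma laid_out_shifts_left i s : laid_out (shifts_left Sigma i s) s (s + (2 * i + 1)).
Proof.
elim: i s => [|i IH] s.
  by apply: laid_out_cons2; rewrite muln0 add0n addn1; apply: laid_out_nil.
apply: laid_out_cons2; apply: laid_out_cons.
by rewrite (_ : s + _ = s.+2 + (2 * i + 1)) //; lia.
Qed.

Lemma laid_out_shifts_right i s : laid_out (shifts_right Sigma i s) s (s + (3 * i + 1)).
Proof.
elim: i s => [|i IH] s.
  by apply: laid_out_cons; rewrite muln0 add0n addn1; apply: laid_out_nil.
do 2 apply: laid_out_cons; apply: laid_out_cons2.
by rewrite (_ : s + _ = s.+3 + (3 * i + 1)) //; lia.
Qed.

Lemma laid_out_compile c s : laid_out (compile Sigma c s) s (s + states_of c).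
Proof.
elim: c s => [|||i|i|c1 IH1 c2 IH2|i c IH] s.
- by rewrite addn0; apply: laid_out_nil.
- by do 3 apply: laid_out_cons; rewrite addn3; apply: laid_out_nil.
- by apply: laid_out_cons2; rewrite addn1; apply: laid_out_nil.
- apply: laid_out_cat (laid_out_moves_right i s) _; apply: laid_out_cons.
  rewrite (_ : s + states_of _ = (s + i).+1 + (2 * i + 1)); last by rewrite /=; lia.
  exact: laid_out_shifts_left.
- apply: laid_out_cat (laid_out_moves_right i s) _.
  by rewrite [states_of _]/= addnA; apply: laid_out_shifts_right.
- apply: laid_out_cat (IH1 s) _.
  by rewrite [states_of _]/= addnA; apply: IH2.
- apply: laid_out_cat (laid_out_moves_right i s) _.
  apply: laid_out_cons; apply: laid_out_cons2.
  apply: laid_out_cat (laid_out_moves_left i _) _.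
  apply: laid_out_cat (IH _) _; apply: laid_out_cons.
  rewrite (_ : s + states_of _ = ((s + i).+2 + 3 * i + states_of c).+1 + 3 * i).
    exact: laid_out_moves_left.
  by rewrite /=; lia.
Qed.

End Determinism.

(** * Stack commands for partial computable functions *)

Definition add_top k := While 0 (Seq (Dec 0) (Inc k)).
Definition clear k := While k (Dec k).
Definition nip := Seq (clear 1) (Seq (add_top 1) Pop).
(** Reading an entry destroys it, so it is moved into two fresh entries at once; the top one is then
    used up to restore the original. *)
Definition copy i :=
  Seq Push (Seq Push (Seq (While i.+2 (Seq (Dec i.+2) (Seq (Inc 0) (Inc 1))))
    (Seq (add_top i.+2) Pop))).

(** The values are pushed starting with the last one; the positions [a] of the arguments are shifted
    by the number of values already on the stack. *)
Fixpoint push_all (I : Type) (c : I -> seq nat -> command) (r : seq I) (a : seq nat) :=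
  if r is i :: r' then Seq (push_all c r' a) (c i (map (addn (size r')) a)) else Skip.

Definition compose (m : nat) (cf : seq nat -> command)
    (cg : 'I_m -> seq nat -> command) a :=
  Seq (push_all cg (enum 'I_m) a)
    (Seq (cf (iota 0 m)) (iter m (fun c => Seq nip c) Skip)).

(** The stack is [[:: c, j, u & S]] with [c] rounds left, index [j] and current value [u]. The new
    value is computed on top and moved into the place of [u]. *)
Definition recursion_body (cg : seq nat -> command) a :=
  Seq (cg [:: 1, 2 & map (addn 3) a])
    (Seq (clear 3) (Seq (add_top 3) (Seq Pop (Seq (Dec 0) (Inc 1))))).

Definition recursion cf cg (a : seq nat) :=
  Seq (cf (behead a)) (Seq Push (Seq (copy (head 0 a).+2)
    (Seq (While 0 (recursion_body cg (behead a))) (Seq Pop Pop)))).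

(** The stack is [[:: u, z & S]], where [u] is the value of the tested function at [z]. *)
Definition minimize_body (cf : seq nat -> command) a :=
  Seq Pop (Seq (Inc 0) (cf (0 :: map succn a))).

Definition minimize cf a :=
  Seq Push (Seq (cf (0 :: map succn a)) (Seq (While 0 (minimize_body cf a)) Pop)).

Section Execution.

Variable Sigma : alphabet.
Local Notation does := (does Sigma).
Implicit Types (S T U a : seq nat).

Lemma does_add_top T v w U :
  does (add_top (size T).+1) (v :: T ++ w :: U) (0 :: T ++ v + w :: U).
Proof.
elim: v w => [|v IH] w; first exact: (does_while0 [::] _ _).
apply: (does_whileS [::]); last by rewrite addSnnS; apply: IH.
apply: (does_seq _) (does_dec [::] _ _) _.
exact: (does_inc (v :: T) w U).
Qed.

Lemma does_clear T v U : does (clear (size T)) (T ++ v :: U) (T ++ 0 :: U).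
Proof.
elim: v => [|v IH]; first exact: does_while0.
have : does (Dec (size T)) (T ++ v.+1 :: U) (T ++ v :: U) by apply: does_dec.
have [w [S eqS]] : exists w S, T ++ v :: U = w :: S.
  by case: T {IH} => [|w T]; [exists v, U | exists w, (T ++ v :: U)].
by move: IH; rewrite eqS => IH dec; apply: does_whileS dec IH.
Qed.

Arguments does_add_top : clear implicits.
Arguments does_clear : clear implicits.

Lemma does_nip v w S : does nip [:: v, w & S] (v :: S).
Proof.
apply: (does_seq _) (does_clear [:: v] w S) _.
apply: (does_seq _) (does_add_top [::] v 0 S) _.
by rewrite addn0; apply: does_pop.
Qed.

Lemma does_copy S i : i < size S -> does (copy i) S (nth 0 S i :: S).
Proof.
move=> lt_i; have [T [v [U [-> <-]]]] : exists T v U, S = T ++ v :: U /\ size T = i.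
  exists (take i S), (nth 0 S i), (drop i.+1 S).
  by rewrite -drop_nth // cat_take_drop size_takel // ltnW.
have [x [S' eqS]] : exists x S', T ++ v :: U = x :: S'.
  by case: T => [|w T]; [exists v, U | exists w, (T ++ v :: U)].
rewrite nth_cat ltnn subnn /= /copy {1}eqS.
apply: (does_seq _) (does_push _ _) _; apply: (does_seq _) (does_push _ _) _.
rewrite -eqS.
have loop w x1 x2 : does (While (size T).+2 (Seq (Dec (size T).+2) (Seq (Inc 0) (Inc 1))))
    [:: x1, x2 & T ++ w :: U] [:: w + x1, w + x2 & T ++ 0 :: U].
  elim: w x1 x2 => [|w IH] x1 x2; first exact: (does_while0 [:: x1, x2 & T] _ _).
  apply: (does_whileS [:: x1, x2 & T]); last by rewrite !addSnnS; apply: IH.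
  apply: (does_seq _) (does_dec [:: x1, x2 & T] _ _) _.
  by apply: (does_seq _) (does_inc [::] _ _) (does_inc [:: _] _ _).
apply: (does_seq _) (loop v 0 0) _; rewrite addn0.
apply: (does_seq _) (does_add_top (v :: T) v 0 U) _; rewrite addn0.
exact: does_pop.
Qed.

Lemma does_nips m v S S' : size S = m ->
  does (iter m (fun c => Seq nip c) Skip) (v :: S ++ S') (v :: S').
Proof.
move=> <-; elim: S => [|w S IH] /=; first exact: does_skip.
exact: (does_seq _) (does_nip _ _ _) IH.
Qed.

(* [a] lists the positions in the stack of the arguments of the function. *)
Definition computes n (c : seq nat -> command) (f : pfun n) :=
  forall a S (x : n.-tuple nat) y, 0 < size S -> all (fun p => p < size S) a ->
    [seq nth 0 S p | p <- a] = x -> f x = Some y -> does (c a) S (y :: S).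

Lemma map_nth_cat T S a : [seq nth 0 (T ++ S) p | p <- map (addn (size T)) a] =
  [seq nth 0 S p | p <- a].
Proof.
rewrite -map_comp; apply: eq_map => p /=.
by rewrite nth_cat ltnNge leq_addr addKn.
Qed.

Lemma all_lt_cat T S a : all (fun p => p < size (T ++ S)) (map (addn (size T)) a) =
  all (fun p => p < size S) a.
Proof. by rewrite all_map; apply: eq_all => p /=; rewrite size_cat ltn_add2l. Qed.

Lemma computes_compose m n cf (cg : 'I_m -> seq nat -> command) (f : pfun m)
    (g : 'I_m -> pfun n) (h : pfun n) :
  computes cf f -> (forall i, computes (cg i) (g i)) ->
  (forall x y, h x = Some y -> exists z : m.-tuple nat,
     (forall i, g i x = Some (tnth z i)) /\ f z = Some y) ->
  computes (compose cf cg) h.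
Proof.
move=> dof dog hE a S x y S_gt0 aS aE /hE[z [gz fz]].
have push r : does (push_all cg r a) S ([seq tnth z i | i <- r] ++ S).
  elim: r => [|i r IH] /=; first exact: does_skip.
  apply: (does_seq _) IH _; rewrite -(size_map (tnth z)).
  apply: (dog i _ _ x) => //; first by rewrite size_cat addn_gt0 S_gt0 orbT.
    by rewrite all_lt_cat.
  by rewrite map_nth_cat.
apply: (does_seq _) (push _) _; rewrite map_tnth_enum.
apply: (does_seq (y :: z ++ S)); last by apply: does_nips; rewrite size_tuple.
apply: (dof _ _ z) => //; first by rewrite size_cat addn_gt0 S_gt0 orbT.
  by apply/allP => p; rewrite mem_iota size_cat size_tuple => /andP[_ /ltn_addr].
apply: (@eq_from_nth _ 0); rewrite size_map size_iota ?size_tuple // => p lt_p.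
by rewrite (nth_map 0) ?size_iota // nth_iota // nth_cat size_tuple lt_p.
Qed.

Lemma computes_recursion n cf cg (f : pfun n) (g : pfun n.+2) (h : pfun n.+1) :
  computes cf f -> computes cg g ->
  (forall x : n.-tuple nat, h [tuple of 0 :: x] = f x) ->
  (forall i (x : n.-tuple nat), h [tuple of i.+1 :: x]
     = obind (fun w => g [tuple of i :: w :: x]) (h [tuple of i :: x])) ->
  computes (recursion cf cg) h.
Proof.
move=> dof dog h0 hS a S /tupleP[i x] y S_gt0.
case: a => [|p a] // /andP[pS aS] [pE aE] hy.
(* A value of [h] at [j + d] requires one at [j], since [obind] propagates undefinedness; so all
   intermediate values exist. *)
have h_lower d j y' : h [tuple of j + d :: x] = Some y' ->
    exists w, h [tuple of j :: x] = Some w.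
  elim: d y' => [|d IH] y'; first by rewrite addn0 => ->; exists y'.
  by rewrite addnS hS; case: (h _) IH => // w /(_ w erefl).
have [w hw] := h_lower i 0 y hy.
have fw : f x = Some w by rewrite -h0.
rewrite /recursion; apply: (does_seq _) (dof _ _ x w S_gt0 aS aE fw) _.
apply: (does_seq _) (does_push _ _) _.
apply: (does_seq _) (does_copy (S := [:: 0, w & S]) (i := p.+2) pS) _; rewrite /= pE.
suff loop c j u : h [tuple of j :: x] = Some u -> h [tuple of j + c :: x] = Some y ->
    does (While 0 (recursion_body cg a)) [:: c, j, u & S] [:: 0, j + c, y & S].
  apply: (does_seq _) (loop i 0 w hw hy) _.
  by apply: (does_seq _) (does_pop _ _) (does_pop _ _).
elim: c j u => [|c IH] j u hu; rewrite ?addn0 => huy.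
  by move: huy; rewrite hu => -[->]; apply: (does_while0 [::] _ _).
have [u' hu'] : exists u', h [tuple of j.+1 :: x] = Some u'.
  by apply: (h_lower c _ y); rewrite addSnnS.
apply: (does_whileS [::]); last by rewrite -addSnnS in huy *; apply: IH hu' huy.
have gu' : g [tuple of j :: u :: x] = Some u' by rewrite -hu' hS hu.
apply: (does_seq _).
  apply: (dog _ _ _ u' _ _ _ gu') => //=; first by rewrite (all_lt_cat [:: _; _; _] S).
  by rewrite (map_nth_cat [:: _; _; _] S) aE.
apply: (does_seq _) (does_clear [:: u'; c.+1; j] u S) _.
apply: (does_seq _) (does_add_top [:: c.+1; j] u' 0 S) _; rewrite addn0.
apply: (does_seq _) (does_pop _ _) _.
by apply: (does_seq _) (does_dec [::] _ _) (does_inc [:: c] _ _).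
Qed.

Lemma does_minimize_body n cf (f : pfun n.+1) a S (x : n.-tuple nat) z u v :
  computes cf f -> all (fun p => p < size S) a -> [seq nth 0 S p | p <- a] = x ->
  f [tuple of z.+1 :: x] = Some v ->
  does (minimize_body cf a) [:: u, z & S] [:: v, z.+1 & S].
Proof.
move=> dof aS aE fv.
apply: (does_seq _) (does_pop _ _) _; apply: (does_seq _) (does_inc [::] _ _) _.
apply: (dof _ _ _ v _ _ _ fv) => //=; first by rewrite (all_lt_cat [:: _] S).
by rewrite (map_nth_cat [:: _] S) aE.
Qed.

Lemma computes_minimize n cf (f : pfun n.+1) (h : pfun n) : computes cf f ->
  (forall (x : n.-tuple nat) y, h x = Some y ->
     f [tuple of y :: x] = Some 0 /\
     forall z, z < y -> exists w, f [tuple of z :: x] = Some w.+1) ->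
  computes (minimize cf) h.
Proof.
move=> dof hE a [|b S] x y // _ aS aE /hE[fy flt].
have f0 : exists v, f [tuple of 0 :: x] = Some v.
  by case: y {hE} fy flt => [|y] fy flt; [exists 0 | have [] := flt 0 isT; eauto].
have [v fv] := f0.
apply: (does_seq _) (does_push _ _) _.
apply: (does_seq [:: v, 0, b & S]).
  apply: (dof _ _ _ v _ _ _ fv) => //=; first by rewrite (all_lt_cat [:: _] (b :: S)).
  by rewrite (map_nth_cat [:: _] (b :: S)) aE.
suff loop d z u : z + d = y -> f [tuple of z :: x] = Some u ->
    does (While 0 (minimize_body cf a)) [:: u, z, b & S] [:: 0, y, b & S].
  exact: (does_seq _) (loop y 0 v erefl fv) (does_pop _ _).
elim: d z u => [|d IH] z u zd fu.
  rewrite addn0 in zd; move: fu; rewrite zd fy => -[<-].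
  exact: (does_while0 [::] _ _).
have [u' fu'] : exists u', f [tuple of z.+1 :: x] = Some u'.
  have : z.+1 <= y by rewrite -zd addnS ltnS leq_addr.
  rewrite leq_eqVlt => /predU1P[->|/flt[u' ->]]; first by exists 0.
  by exists u'.+1.
have [u0 fu0] : exists u0, f [tuple of z :: x] = Some u0.+1.
  by apply: flt; rewrite -zd addnS ltnS leq_addr.
move: fu; rewrite fu0 => -[<-]; apply: (does_whileS [::]).
  exact: does_minimize_body dof aS aE fu'.
by apply: IH => //; rewrite addSnnS.
Qed.

(** Induction on the derivation. Since [computes] speaks only of arguments with a value, no loop has
    to be shown to diverge here. *)
Lemma partial_computable_computes n (f : pfun n) :
  partial_computable f -> exists c, computes c f.
Proof.
elim=> {n f} [n||n i|m n f g h _ [cf dof] _ dog hE|n f g h _ [cf dof] _ [cg dog] h0 hS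
  |n f h _ [cf dof] hE].
- by exists (fun=> Push) => a [|v S] x y // _ _ _ [<-]; apply: does_push.
- exists (fun a => Seq (copy (head 0 a)) (Inc 0)) => a S x y S_gt0 aS aE [<-].
  move: aE; case/tupleP: x => v x; case: a aS => [|p a] //= /andP[pS _] [<- _].
  rewrite theadE.
  exact: (does_seq _) (does_copy pS) (does_inc [::] _ _).
- exists (fun a => copy (nth 0 a i)) => a S x y S_gt0 aS aE [<-].
  have sa : size a = n by rewrite -(size_map (nth 0 S)) aE size_tuple.
  rewrite (tnth_nth 0) -aE (nth_map 0) ?sa //.
  by apply: does_copy; apply: (allP aS); rewrite mem_nth ?sa.
- have [cg dog'] := choice dog.
  by exists (compose cf cg); apply: computes_compose dof dog' _ => x y /hE.
- by exists (recursion cf cg); apply: computes_recursion dof dog h0 hS.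
- by exists (minimize cf); apply: computes_minimize dof _ => x y /hE.
Qed.

(** * Divergence *)

Implicit Types (Q : program Sigma).

Lemma iter_halted Q c k : halted Q c -> iter k (step Q) c = c.
Proof.
move=> Hc; elim: k => //= k ->; move: Hc; rewrite /halted /step.
by case: lookup.
Qed.

Lemma halted_iter_leq Q c j k : j <= k -> halted Q (iter j (step Q) c) ->
  iter k (step Q) c = iter j (step Q) c.
Proof. by move=> jk Hj; rewrite -(subnK jk) iterD iter_halted. Qed.

Definition diverges Q c := forall j, ~~ halted Q (iter j (step Q) c).

Lemma reach_diverges Q c c' : reach Q c c' -> diverges Q c' -> diverges Q c.
Proof.
move=> [m mE] dc' j; apply/negP => Hj.
have := dc' j; rewrite -mE -iterD addnC.
by rewrite (halted_iter_leq (leq_addl _ _) Hj) Hj.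
Qed.

(** A halted configuration reaches only itself, so no member of the family is halted. Each passage
    to the next member takes at least one step, which gives the induction on the number of steps. *)
Lemma reach_sequence_diverges Q (Z : Type) (c : Z -> config Sigma) :
  (forall z, exists z', c z' <> c z /\ reach Q (c z) (c z')) ->
  forall z, diverges Q (c z).
Proof.
move=> next z j; elim: j z => [|j IH] z; have [z' [neq [m mE]]] := next z; apply/negP.
  by move=> /(iter_halted m); rewrite mE.
move=> Hj; have /negP := IH z'; apply; rewrite -mE -iterD.
rewrite (halted_iter_leq _ Hj) // -addn1 leq_add2l lt0n.
by apply/eqP => m0; apply: neq; rewrite -mE m0.
Qed.

Lemma strokes_inj k k' (r r' : seq Sigma) :
  nseq k (stroke Sigma) ++ blank Sigma :: r =
  nseq k' (stroke Sigma) ++ blank Sigma :: r' -> k = k' /\ r = r'.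
Proof.
have /eqP neq := blank_neq_stroke Sigma.
elim: k k' => [|k IH] [|k'] /= [].
- by move=> ->.
- by move=> /neq.
- by move=> /esym/neq.
- by move=> /IH[-> ->].
Qed.

Lemma input_tape_inj : injective (input_tape Sigma).
Proof.
elim=> [|v S IH] [|v' S'] //; rewrite !input_tape_cons // => -[].
by move=> /strokes_inj[-> /IH->].
Qed.

(** Each round of the loop ends at the start of the next one with [z] increased, and different
    stacks give different tapes; so the starts of the rounds form a family as in
    [reach_sequence_diverges]. *)
Lemma minimize_diverges n cf (f : pfun n.+1) a S (x : n.-tuple nat) Q s k :
  computes cf f -> 0 < size S -> all (fun p => p < size S) a ->
  [seq nth 0 S p | p <- a] = x ->
  (forall z, exists w, f [tuple of z :: x] = Some w.+1) ->
  implements Q (compile Sigma (minimize cf a) s) ->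
  diverges Q (Config s (left_tape Sigma [::] k) (input_tape Sigma S)).
Proof.
move=> dof; case: S => // b S _ aS aE fpos.
have [u fu] := choice fpos.
move=> /implements_cat[/(does_push b S) push] /implements_cat[Qf].
move=> /implements_cat[Qw _].
have df : does (cf (0 :: map succn a)) [:: 0, b & S] [:: (u 0).+1, 0, b & S].
  apply: (dof _ _ _ _ _ _ _ (fu 0)) => //=; first by rewrite (all_lt_cat [:: _] (b :: S)).
  by rewrite (map_nth_cat [:: _] (b :: S)) aE.
have [k' r] := leads_trans push (df _ _ Qf) k.
apply: reach_diverges r _; move: Qw.
set t := (s + states_of Push + states_of (cf _)) => Qw.
(* The number of explicit blanks after a round is only known to exist, so it is carried along in the
   index. *)
pose c zk := Config t (left_tape Sigma [::] zk.2)
  (input_tape Sigma [:: (u zk.1).+1, zk.1, b & S]).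
apply: (@reach_sequence_diverges _ _ c _ (0, k')) => -[z kz].
have body := does_minimize_body (u z).+1 dof aS aE (fu z.+1).
have [kz' rz] := @leads_while_iteration _ _ _ [::] _ _ _ _ _ Qw body kz.
exists (z.+1, kz'); split=> // /(congr1 (@rtape Sigma)) /input_tape_inj[_ /esym/n_Sn []].
Qed.

End Execution.

(** * Semantics of Turing programs *)

Section Semantics.

Variable Sigma : alphabet.
Implicit Types P Q : program Sigma.

Lemma stops_within_run P x j k : stops_within P x j -> j <= k -> run P x k = run P x j.
Proof. by move=> Hj jk; apply: halted_iter_leq. Qed.

Lemma stops_within_leq P x j k : j <= k -> stops_within P x j -> stops_within P x k.
Proof. by move=> jk Hj; rewrite /stops_within (stops_within_run Hj jk). Qed.

Lemma Sem_stops n P (x : n.-tuple nat) j :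
  stops_within P x j -> Sem n P x = Some (output (run P x j)).
Proof.
move=> Hj; rewrite /Sem; case: pselect => [exj|]; last by case; exists j.
by case: ex_minnP => m Hm /(_ j Hj) mj; rewrite (stops_within_run Hm mj).
Qed.

Lemma isSome_Sem n P (x : n.-tuple nat) :
  isSome (Sem n P x) <-> exists j, stops_within P x j.
Proof.
split=> [|[j Hj]]; last by rewrite (Sem_stops Hj).
by rewrite /Sem; case: pselect.
Qed.

Lemma Sem_reach n P (x : n.-tuple nat) c :
  reach P (Config 0 [::] (input_tape Sigma x)) c -> halted P c ->
  Sem n P x = Some (output c).
Proof. by move=> [j <-] Hj; rewrite (@Sem_stops _ _ _ j). Qed.

Lemma Sem_diverges n P (x : n.-tuple nat) :
  diverges P (Config 0 [::] (input_tape Sigma x)) -> Sem n P x = None.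
Proof.
move=> div; case E: (Sem n P x) => [y|] //.
have /isSome_Sem[j] : isSome (Sem n P x) by rewrite E.
by rewrite /stops_within => Hj; have := div j; rewrite Hj.
Qed.

End Semantics.

(** * The s-m-n theorem for Turing programs *)

Section Parametrization.

Variables (Sigma : alphabet) (c : command).
Let B := blank Sigma.
Let I := stroke Sigma.

Let final := 4 + states_of c.
(* State [final.+1] has no instruction: the program halts there. *)
Let counter := final.+2.

(** The parameter is kept in the state: in state [counter + j] there are [j] strokes left to be
    written. [Push] has already supplied the first stroke of the block. *)
Fixpoint countdown i : program Sigma :=
  if i is i'.+1 then Instruction (counter + i) B I Lft (counter + i') :: countdown i'
  else [::].

Definition main_part : program Sigma :=
  compile Sigma c 4 ++ [:: Instruction final I B Rgt final.+1;
                           Instruction counter B B Rgt 4].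

(* The final step erases one stroke, since a block of [v + 1] strokes stands for
   [v] on the input side but for the output [v + 1]. *)
Definition parametrized i : program Sigma :=
  compile Sigma Push 0 ++ Instruction 3 I I Lft (counter + i)
    :: countdown i ++ main_part.

(** Clashes do not depend on the order of the list; [countdown] precedes [main_part] although its
    states are larger. *)
Lemma laid_out_catC (P1 P2 : program Sigma) a m b :
  laid_out P1 m b -> laid_out P2 a m -> laid_out (P1 ++ P2) a b.
Proof.
move=> l1 l2; have /and3P[ab u s] := laid_out_cat l2 l1.
apply/and3P; split=> //.
  by move: u; rewrite /keys !map_cat uniq_catC.
by move: s; rewrite /keys !map_cat !all_cat andbC.
Qed.

Lemma laid_out_main_part : laid_out main_part 4 counter.+1.
Proof.
apply: laid_out_cat (laid_out_compile Sigma c 4) _.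
apply: laid_out_cons; apply: (@laid_out_catC [::] _ _ counter.+1).
  exact: laid_out_nil.
rewrite -/final /laid_out /= /counter; apply/and3P; split; lia.
Qed.

Lemma laid_out_countdown i : laid_out (countdown i) counter.+1 (counter + i).+1.
Proof.
elim: i => [|i IH]; first by rewrite addn0; apply: laid_out_nil.
apply: (@laid_out_catC [:: _] _ _ _ _ _ IH); rewrite addnS.
by apply: laid_out_cons; apply: laid_out_nil.
Qed.

Lemma laid_out_parametrized i : laid_out (parametrized i) 0 (counter + i).+1.
Proof.
apply: laid_out_cat (laid_out_compile Sigma Push 0) _; apply: laid_out_cons.
exact: laid_out_catC (laid_out_countdown i) laid_out_main_part.
Qed.

Lemma parametrized_start i v S :
  leads (parametrized i) 0 [::] (v :: S) 4 [::] [:: i, v & S].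
Proof.
have := laid_out_implements (laid_out_parametrized i).
rewrite {2}/parametrized; set Q := parametrized i.
move=> /implements_cat[/(does_push v S) push [Q3]] /implements_cat[Qd].
move=> /implements_cat[_ [_ [Q0 _]]].
(* One of the [k] blanks comes under the head with the step to the left, up to [i] more are used by
   the countdown, and the last step to the right puts one blank back. *)
apply: leads_trans push _ => k; exists (k.-1 - i).+1.
rewrite !input_tape_cons; apply: reach_step; rewrite (step_left _ _ Q3).
rewrite head_left_tape.
have -> : behead (left_tape Sigma [::] k) = left_tape Sigma [::] k.-1 by case: k.
suff down j l r : implements Q (countdown j) ->
    reach Q (Config (counter + j) (nseq l B) (B :: r))
            (Config 4 (B :: nseq (l - j) B) (nseq j I ++ r)).
  apply: reach_trans (down i k.-1 _ Qd) _.
  by rewrite nseq_cat_cons; apply: reach_refl.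
elim: j l r => [|j IH] l r.
  by rewrite addn0 subn0 => _; apply: reach_step; rewrite (step_right _ _ Q0); apply: reach_refl.
move=> [Qj /(IH l.-1 (I :: r)) r1]; apply: reach_step; rewrite (step_left _ _ Qj).
have -> : l - j.+1 = l.-1 - j by lia.
by rewrite /= -nseq_cat_cons; case: l r1.
Qed.

Lemma implements_parametrized i : implements (parametrized i) (compile Sigma c 4).
Proof.
have := laid_out_implements (laid_out_parametrized i).
by rewrite {2}/parametrized => /implements_cat[_ [_ /implements_cat[_ /implements_cat[]]]].
Qed.

Lemma lookup_None (P : program Sigma) q a :
  all (fun k => k.1 != q) (keys P) -> lookup P q a = None.
Proof. by elim: P => //= i P IH /andP[/negbTE-> /IH]. Qed.

Lemma parametrized_halts i a : lookup (parametrized i) final.+1 a = None.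
Proof.
have keys_cat P1 P2 : keys (P1 ++ P2) = @keys Sigma P1 ++ keys P2 by apply: map_cat.
have keys_cons j P : keys (j :: P) = (in_state j, @scanned Sigma j) :: keys P by [].
have /and3P[_ _ sc] := laid_out_compile Sigma c 4.
have /and3P[_ _ sd] := laid_out_countdown i.
apply: lookup_None; rewrite /parametrized /main_part [compile _ Push _]/=.
rewrite !(keys_cat, keys_cons).
move: (keys (compile Sigma c 4)) (keys (countdown i)) sc sd => kc kd sc sd.
rewrite /= all_cat /= all_cat /= -/final.
rewrite (sub_all _ sd) => [|k]; last by rewrite /counter /final; lia.
rewrite (sub_all _ sc) => [|k]; last by rewrite /final; lia.
by rewrite /counter /final; lia.
Qed.

Lemma Sem_parametrized n (x : n.-tuple nat) i v : 0 < n ->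
  does Sigma c (i :: x) [:: v] -> Sem n (parametrized i) x = Some v.
Proof.
move=> n_gt0 dc; have [u [S xE]] : exists u S, tval x = u :: S.
  by case: x {dc} => -[|u S] /= sx; [move: sx n_gt0; case: n | exists u, S].
have start := parametrized_start i u S.
rewrite -xE in start.
have [k r] := leads_trans start (dc _ _ (implements_parametrized i)) 0.
pose e := Config final.+1 (B :: nseq k B) (nseq v I ++ [:: B]).
have vE : output e = v.
  rewrite /output /e /= count_cat !count_nseq /= !eqxx (negbTE (blank_neq_stroke _)).
  by rewrite mul0n mul1n !addn0.
rewrite -vE; apply: Sem_reach; last by rewrite /halted parametrized_halts.
apply: reach_trans r _.
have := laid_out_implements (laid_out_parametrized i).
rewrite {2}/parametrized; set Q := parametrized i.
move=> /implements_cat[_ [_ /implements_cat[_ /implements_cat[_ [Qf _]]]]].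
by rewrite input_tape_cons; apply: reach_step; rewrite (step_right _ _ Qf); apply: reach_refl.
Qed.

Lemma Sem_parametrized_diverges n (x : n.-tuple nat) i : 0 < n ->
  (forall k, diverges (parametrized i)
     (Config 4 (left_tape Sigma [::] k) (input_tape Sigma (i :: x)))) ->
  Sem n (parametrized i) x = None.
Proof.
move=> n_gt0 div; have [u [S xE]] : exists u S, tval x = u :: S.
  by case: x {div} => -[|u S] /= sx; [move: sx n_gt0; case: n | exists u, S].
have [k r] := parametrized_start i u S 0.
by apply: Sem_diverges; rewrite xE; apply: reach_diverges r _; rewrite -xE.
Qed.

(** Only the jump out of state 3 and the countdown depend on [i]; the latter is built by primitive
    recursion on top of the constant code of [main_part]. *)
Lemma computable_parametrized_code : computable1 (fun i => program_code (parametrized i)).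
Proof.
have ccons := computable_cons_code.
pose code5 q (a b : Sigma) d q' := cons_code q (cons_code (enum_rank a)
  (cons_code (enum_rank b) (cons_code (move_code d) (cons_code q' 0)))).
have rec_code5 m F1 (a b : Sigma) d F2 : recursive m F1 -> recursive m F2 ->
    recursive m (fun s => code5 (F1 s) a b d (F2 s)).
  by move=> rec1 rec2; rewrite /code5; prove_recursive.
have rec_down : recursive 1 (fun s => program_code (countdown (nth 0 s 0) ++ main_part)).
  pose G s := cons_code
    (code5 (counter + (nth 0 s 0).+1) B I Lft (counter + nth 0 s 0)) (nth 0 s 1).
  have recG : recursive 3 G.
    have rec5 : recursive 3 (fun s =>
        code5 (counter + (nth 0 s 0).+1) B I Lft (counter + nth 0 s 0)).
      by apply: rec_code5; prove_recursive.
    by rewrite /G; prove_recursive.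
  have := recursive_rec (recursive_const 1 (program_code main_part)) recG
    (@recursive_nth 1 0 isT).
  by apply: recursive_ext => s _; elim: (nth 0 s 0) => //= j ->.
have rec3 : recursive 1 (fun s => code5 3 I I Lft (counter + nth 0 s 0)).
  by apply: rec_code5; prove_recursive.
have rec_prefix r F : recursive 1 F -> recursive 1 (fun s => foldr cons_code (F s) r).
  by move=> recF; elim: r => //= x r recr; prove_recursive.
rewrite -recursive_computable1.
apply: (rec_prefix [seq instruction_code j | j <- compile Sigma Push 0] (fun s =>
  cons_code (code5 3 I I Lft (counter + nth 0 s 0))
            (program_code (countdown (nth 0 s 0) ++ main_part)))).
by prove_recursive.
Qed.

End Parametrization.

(** From the stack [i :: x] the program minimises [F], evaluates [G] with the zero [t] on top, and
    removes everything below the result. Without a zero it is caught in the loop of [minimize]. *)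
Lemma search_program (Sigma : alphabet) n F G :
  0 < n -> recursive n.+2 F -> recursive n.+2 G ->
  exists2 P : nat -> program Sigma, computable1 (fun i => program_code (P i)) &
  forall i (x : n.-tuple nat),
    (forall t, F [:: t, i & x] = 0 -> (forall z, z < t -> F [:: z, i & x] <> 0) ->
       Sem n (P i) x = Some (G [:: t, i & x])) /\
    ((forall t, F [:: t, i & x] <> 0) -> Sem n (P i) x = None).
Proof.
move=> n_gt0 recF recG.
have [cf dof] := partial_computable_computes Sigma recF.
have [cg dog] := partial_computable_computes Sigma recG.
pose c := Seq (minimize cf (iota 0 n.+1))
  (Seq (cg (iota 0 n.+2)) (iter n.+2 (fun c => Seq nip c) Skip)).
exists (parametrized Sigma c); first exact: computable_parametrized_code.
move=> i x; pose ix := [tuple of i :: x].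
have all_iota m : all (fun p => p < m) (iota 0 m).
  by apply/allP => p; rewrite mem_iota.
have map_iota (S : seq nat) m : size S = m -> [seq nth 0 S p | p <- iota 0 m] = S.
  by move=> <-; apply: mkseq_nth.
split=> [t Ft Flt|Fpos].
  apply: Sem_parametrized => //.
  apply: (does_seq (t :: ix)).
    (* The assumptions on [F] concern only the arguments [i :: x], so the minimisation is described
       by a function defined there alone. *)
    pose h : pfun n.+1 := fun y => if y == ix then Some t else None.
    have doh : computes Sigma (minimize cf) h.
      apply: computes_minimize dof _ => y v; rewrite /h; case: eqP => // -> [<-].
      split; first by rewrite /= Ft.
      by move=> z /Flt /=; case: (F _) => // w _; exists w.
    apply: (doh _ _ ix); rewrite ?size_tuple //; first exact: map_iota (size_tuple ix).
    by rewrite /h eqxx.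
  have sz : size (t :: ix) = n.+2 by rewrite /= size_tuple.
  apply: (does_seq (G (t :: ix) :: t :: ix)).
    by apply: (dog _ _ [tuple of t :: ix]) => //; [rewrite sz | apply: map_iota].
  by have := @does_nips Sigma n.+2 (G (t :: ix)) (t :: ix) [::] sz; rewrite cats0.
apply: Sem_parametrized_diverges => // k.
have [Qm _] := iffLR (implements_cat _ _ _) (implements_parametrized Sigma c i).
apply: (minimize_diverges k dof _ _ _ _ Qm (x := ix)).
- by [].
- by rewrite size_tuple.
- exact: map_iota (size_tuple ix).
- by move=> z /=; have := Fpos z; case: (F _) => [|w] // _; exists w.
Qed.

(** * Cubes and the modified function *)

Lemma cube_bound n a (f : n.-tuple nat -> nat) :
  exists b, forall x, cube n a x -> f x <= b.
Proof.
pose r := [seq [tuple nat_of_ord (tnth y i) | i < n] | y <- enum {: n.-tuple 'I_a}].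
exists (\max_(x <- r) f x) => x cx; apply: leq_bigmax_seq => //.
apply/mapP; exists [tuple Ordinal (cx i) | i < n]; first by rewrite mem_enum.
by apply: eq_from_tnth => i; rewrite !tnth_mktuple.
Qed.

Lemma cube_subset n a b : a <= b -> cube n a `<=` cube n b.
Proof. by move=> ab x cx i; apply: leq_trans (cx i) ab. Qed.

Lemma cube_cover n (x : n.-tuple nat) : exists b, forall a, b <= a -> cube n a x.
Proof.
exists (\max_(i < n) (tnth x i).+1) => a ba i.
by apply: leq_trans ba; apply: (leq_bigmax i).
Qed.

Lemma infinite_set_unbounded A : infinite_set A -> forall b, exists2 a, A a & b <= a.
Proof.
move=> infA b; apply: contrapT => noa; apply: infA.
apply: sub_finite_set (finite_II b) => a Aa /=.
by rewrite ltnNge; apply/negP => ba; apply: noa; exists a.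
Qed.

Section Modification.

Variables (Sigma : alphabet) (n : nat) (kappa : nat -> n.-tuple nat).
Variables (A : set nat) (e : nat -> nat).
Hypothesis kappa_enum : effective_tuple_enumeration kappa.
Hypothesis e_enum : effective_enumeration e A.

(** The rounds can be eliminated because a cube is finite: if the program stops on all of it, some
    round sees all these computations finished. *)
Lemma modified_functionE (P : program Sigma) x :
  modified_function kappa e P x =
  if pselect (exists a, [/\ A a, cube n a x & cube n a `<=` pdom (Sem n P)])
  then Sem n P x else None.
Proof.
have [_ rangeA] := e_enum; have [_ [g _ gK]] := kappa_enum.
rewrite /modified_function; case: pselect => H1; case: pselect => H2 //; exfalso.
  case: H1 => j [_ [a [[t _ ->] cx cP]]]; apply: H2; exists (e t); split=> //.
    by rewrite -rangeA; exists t.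
  by move=> y /cP[_ sy]; apply/isSome_Sem; exists j.
case: H2 => a [Aa cx cP]; apply: H1.
have /choice[T HT] y : exists t, cube n a y -> stops_within P y t.
  have [/cP/isSome_Sem[t st]|] := pselect (cube n a y); first by exists t.
  by exists 0.
have [bT boundT] := cube_bound a T; have [bg boundg] := cube_bound a g.
move: Aa; rewrite -rangeA => -[t _ ea].
(* A round after the step yielding [a], all stopping times on the cube, and the positions of all its
   points in [kappa]. *)
exists (t + bT + bg).+1; split=> //; exists a; split=> //.
  by exists t; rewrite ?ea //; lia.
move=> y cy; split.
  by exists (g y); rewrite ?gK //; have := boundg y cy; lia.
by apply: stops_within_leq (HT y cy); have := boundT y cy; lia.
Qed.

(** The program is fixed, so its code enters as a constant; totality makes the stopping time [G] a
    total minimisation over the simulated run. *)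
Lemma Sem_total_computable (P : program Sigma) :
  (forall x, isSome (Sem n P x)) -> partial_computable (Sem n P).
Proof.
move=> tot.
pose G (s : seq nat) : nat :=
  if pselect (exists j, stops_within P s j) is left H then ex_minn H else 0.
have Gmin (x : n.-tuple nat) : stops_within P x (G x) /\
    forall j, j < G x -> ~~ stops_within P x j.
  rewrite /G; case: pselect => [H|]; last by move/isSome_Sem: (tot x).
  case: ex_minnP => j Hj minj; split=> // k; rewrite ltnNge => kj.
  by apply/negP => /minj; apply/negP.
have rec_run m F J : recursive m (fun s => input_code Sigma (F s)) -> recursive m J ->
    recursive m (fun s => run_input_code Sigma (program_code P) (F s) (J s)).
  move=> recF recJ; apply: (recursive_op3 (computable_run_code Sigma)) => //.
  exact: recursive_const.
have recG : recursive n G.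
  pose H s := ~~ halted_code Sigma (program_code P)
    (run_input_code Sigma (program_code P) (behead s) (nth 0 s 0)) : nat.
  apply: (@recursive_min n H).
    apply: recursive_neg; apply: recursive_halted_code; first exact: recursive_const.
    apply: rec_run; last exact: recursive_nth.
    by apply: recursive_behead; apply: recursive_input_code.
  move=> s /eqP sn; have [stopG minG] := Gmin (Tuple sn).
  rewrite /H /= run_input_codeE halted_codeE -/(stops_within P s (G s)) stopG.
  by split=> // z /minG; rewrite run_input_codeE halted_codeE => ->.
have -> : Sem n P = fun x => Some (output_code Sigma
    (run_input_code Sigma (program_code P) x (G x))).
  apply: funext => x; have [stopG _] := Gmin x.
  by rewrite (Sem_stops stopG) run_input_codeE output_codeE.
apply: (recursive_op1 (computable_output_code Sigma) (F := fun s =>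
  run_input_code Sigma (program_code P) s (G s))).
by apply: (rec_run n id) recG; apply: recursive_input_code.
Qed.

(** The domain is the union of the cubes with edge in [A] inside the domain of [Sem n P]. Cubes are
    nested: if the edges are unbounded the function is total, and otherwise a largest edge gives the
    domain unless there is none at all. *)
Lemma modified_function_SA (P : program Sigma) : SA n A (modified_function kappa e P).
Proof.
set q := modified_function _ _ _; pose good a := A a /\ cube n a `<=` pdom (Sem n P).
have qS x : q x = if pselect (exists2 a, good a & cube n a x) then Sem n P x else None.
  rewrite /q modified_functionE; case: pselect => H1; case: pselect => H2 //; exfalso.
    by case: H1 => a [Aa cx cP]; apply: H2; exists a.
  by case: H2 => a [Aa cP] cx; apply: H1; exists a.
have dom_q x : isSome (q x) <-> exists2 a, good a & cube n a x.
  rewrite qS; case: pselect => [[a ga cx]|]; last by split.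
  by split=> _; [exists a | apply: (ga.2 x cx)].
have [unb|/existsNP[b nb]] := pselect (forall b, exists2 a, good a & b <= a).
  left; have tot x : isSome (q x).
    have [b hb] := cube_cover x; have [a ga ba] := unb b.
    by apply/dom_q; exists a => //; apply: hb.
  have qE : q = Sem n P.
    by apply: funext => x; have := tot x; rewrite qS; case: pselect.
  split; last by apply/seteqP; split=> x _ //; apply: tot.
  by rewrite qE; apply: Sem_total_computable => x; rewrite -qE.
right; have [exg|nog] := pselect (exists a, good a); last first.
  left; apply/seteqP; split=> x // /dom_q[a ga _].
  by case: nog; exists a.
have exg' : exists a, `[< good a >] by case: exg => a ga; exists a; apply/asboolP.
have bnd a : `[< good a >] -> a <= b.
  move=> /asboolP ga; rewrite leqNgt; apply/negP => ba; apply: nb.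
  by exists a => //; apply: ltnW.
right; case: (ex_maxnP exg' bnd) => a /asboolP ga maxa; exists a; first exact: ga.1.
apply/seteqP; split=> x; last by move=> cx; apply/dom_q; exists a.
move=> /dom_q[a' ga' cx]; apply: cube_subset cx.
by apply: maxa; apply/asboolP.
Qed.

(** Infinity of [A] serves the total functions: every point lies in some cube with edge in [A]. *)
Lemma modified_function_id (P : program Sigma) :
  infinite_set A -> SA n A (Sem n P) -> modified_function kappa e P = Sem n P.
Proof.
move=> infA SAq; apply: funext => x; rewrite modified_functionE.
case: pselect => // noa; case E: (Sem n P x) => [y|] //; exfalso; apply: noa.
have domx : pdom (Sem n P) x by rewrite /pdom /= E.
case: SAq => [[_ tot]|[dom0|[a Aa doma]]].
- have [b hb] := cube_cover x; have [a Aa ba] := infinite_set_unbounded infA b.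
  by exists a; split=> //; [apply: hb | rewrite tot].
- by move: domx; rewrite dom0.
- by exists a; split=> //; [rewrite -doma | rewrite doma].
Qed.

End Modification.

(** Needed to recognise a program found in the enumeration by its code. *)
Lemma program_code_inj (Sigma : alphabet) : injective (@program_code Sigma).
Proof.
apply: inj_comp (can_inj CodeSeq.codeK) _; apply: inj_map.
move=> [q a w d q'] [p b u d' p'] /(can_inj CodeSeq.codeK) /= [-> eqa eqw eqd ->].
move: eqa eqw => /ord_inj/enum_rank_inj-> /ord_inj/enum_rank_inj->.
by move: eqd; case: d; case: d'.
Qed.

(** * Extended graphs *)

Section Pairing.

Variables (pr : nat -> nat -> nat) (pr1 pr2 : nat -> nat).
Hypothesis computable_pr : computable2 pr.
Hypotheses (computable_pr1 : computable1 pr1) (computable_pr2 : computable1 pr2).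
Hypotheses (pr1K : forall x y, pr1 (pr x y) = x) (pr2K : forall x y, pr2 (pr x y) = y).
Hypothesis prK : forall z, pr (pr1 z) (pr2 z) = z.

Fixpoint unpairing m u := if m is m'.+1 then pr1 u :: unpairing m' (pr2 u) else [:: u].

Lemma size_unpairing m u : size (unpairing m u) = m.+1.
Proof. by elim: m u => //= m IH u; rewrite IH. Qed.

Lemma seq_pairingK m s : size s = m.+1 -> unpairing m (seq_pairing pr s) = s.
Proof.
elim: m s => [|m IH] [|x [|y s]] // [sm].
by rewrite [seq_pairing _ _]/= /= pr1K pr2K -/(seq_pairing pr (y :: s)) IH //= sm.
Qed.

Lemma unpairingK m u : seq_pairing pr (unpairing m u) = u.
Proof.
elim: m u => //= m IH u; have := IH (pr2 u); have := size_unpairing m (pr2 u).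
by case: (unpairing m _) => // x s _ ->; apply: prK.
Qed.

Lemma seq_pairing_inj m (x y : m.+1.-tuple nat) :
  seq_pairing pr x = seq_pairing pr y -> x = y.
Proof.
move=> eqxy; apply: val_inj => /=.
by rewrite -(seq_pairingK (size_tuple x)) eqxy seq_pairingK // size_tuple.
Qed.

Lemma seq_pairing_surj m u : exists x : m.+1.-tuple nat, u = seq_pairing pr x.
Proof.
have su : size (unpairing m u) == m.+1 by rewrite size_unpairing.
by exists (Tuple su); rewrite /= unpairingK.
Qed.

Lemma recursive_seq_pairing n : recursive n (seq_pairing pr).
Proof.
have rec_map Gs : all_recursive n Gs ->
    recursive n (fun s => seq_pairing pr [seq G s | G <- Gs]).
  elim: Gs => [|G Gs IH] /=; first by move=> _; apply: recursive_const.
  case: Gs IH => [|H Gs] IH [recG recGs] //.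
  by apply: (recursive_op2 computable_pr recG); apply: IH.
have /rec_map : all_recursive n [seq (fun s => nth 0 s i) | i <- iota 0 n].
  by apply: all_recursive_map => i; rewrite mem_iota; apply: recursive_nth.
apply: recursive_ext => s sn; rewrite -map_comp; congr seq_pairing.
by rewrite -[RHS](mkseq_nth 0) sn.
Qed.

(** Presents the list of components in the form of a list of functions, as substitution requires. *)
Lemma unpairing_recursive m k U : recursive k U -> exists Gs,
  [/\ size Gs = m.+1, all_recursive k Gs &
      forall s, unpairing m (U s) = [seq G s | G <- Gs]].
Proof.
elim: m U => [|m IH] U recU; first by exists [:: U].
have [Gs [sGs recGs eqGs]] := IH _ (recursive_op1 computable_pr2 recU).
exists ((fun s => pr1 (U s)) :: Gs); split=> /=; first by rewrite sGs.
  by split=> //; apply: (recursive_op1 computable_pr1 recU).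
by move=> s; rewrite eqGs.
Qed.

Arguments unpairing : simpl never.

(** A finite table, built by changing one value at a time; it covers the members of [Anf], whose
    domains are finite. *)
Lemma computable_finite_support (phi : nat -> nat) b :
  (forall u, b <= u -> phi u = 0) -> computable1 phi.
Proof.
rewrite -recursive_computable1; elim: b phi => [|b IH] phi phi0.
  by apply: recursive_ext (recursive_const 1 0) => s _; rewrite phi0.
pose psi u := if u == b then 0 else phi u.
have recpsi : recursive 1 (fun s => psi (nth 0 s 0)).
  apply: IH => u bu; rewrite /psi; case: eqP => // /eqP ub.
  by apply: phi0; rewrite ltn_neqAle eq_sym ub.
have : recursive 1 (fun s => if nth 0 s 0 == b then phi b else psi (nth 0 s 0)).
  by apply: recursive_if => //; prove_recursive.
by apply: recursive_ext => s _; rewrite /psi; case: eqP => // ->.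
Qed.

(** Undefinedness is encoded by 0 and a value [v] by [v.+1]. This is computable even for functions
    that are not total, because membership in [SA] makes their domain finite. *)
Lemma SA_graph_function m A (r : pfun m.+1) : SA m.+1 A r ->
  exists2 phi, computable1 phi &
    forall x : m.+1.-tuple nat, phi (seq_pairing pr x) = oapp succn 0 (r x).
Proof.
pose tup u : m.+1.-tuple nat := insubd [tuple of nseq m.+1 0] (unpairing m u).
have tupK (x : m.+1.-tuple nat) : tup (seq_pairing pr x) = x.
  by rewrite /tup seq_pairingK ?size_tuple // valKd.
have tup_val u : tval (tup u) = unpairing m u.
  by rewrite /tup val_insubd size_unpairing eqxx.
pose phi u := oapp succn 0 (r (tup u)).
have phiE (x : m.+1.-tuple nat) : phi (seq_pairing pr x) = oapp succn 0 (r x).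
  by rewrite /phi tupK.
case=> [[pcr tot]|anf].
  exists phi => //; pose F s := odflt 0 (r (insubd [tuple of nseq m.+1 0] s)).
  have rF x : r x = Some (F x).
    have : pdom r x by rewrite tot.
    by rewrite /pdom /= /F valKd; case: (r x).
  have recF : recursive m.+1 F.
    by move: pcr; rewrite (_ : r = fun x => Some (F x)) //; apply: funext.
  have [Gs [sGs recGs eqGs]] := unpairing_recursive m (@recursive_nth 1 0 isT).
  have := recursive_op1 pc_succ (recursive_comp recF sGs recGs).
  rewrite -recursive_computable1; apply: recursive_ext => s _.
  by rewrite -eqGs -tup_val /phi rF.
exists phi => //.
have [b hb] : exists b, forall x : m.+1.-tuple nat, pdom r x -> seq_pairing pr x <= b.
  case: anf => [->|[a _ ->]]; first by exists 0.
  exact: cube_bound.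
apply: (@computable_finite_support _ b.+1) => u bu; rewrite /phi.
case E: (r (tup u)) => [v|] //.
have /hb : pdom r (tup u) by rewrite /pdom /= E.
by rewrite tup_val unpairingK leqNgt bu.
Qed.

Lemma SA_extended_graph m A (r : pfun m.+1) : SA m.+1 A r ->
  exists2 k, computable2 k & forall i, range (k i) = extended_graph pr r.
Proof.
move=> /SA_graph_function[phi cphi phiE].
(* [t] codes a point and a flag: flag 0 gives the entry with 0, any other flag the value entry.
   Where [r] is undefined, [phi] is 0 and the former entry is repeated. *)
exists (fun _ t => pr (pr1 t) (if pr2 t == 0 then 0 else phi (pr1 t))).
  by rewrite -recursive_computable2; prove_recursive.
move=> _; apply/seteqP; split=> [z [t _ <-]|z [[x ->]|[x [v [rx ->]]]]] /=.
- have [x xE] := seq_pairing_surj m (pr1 t); rewrite xE phiE.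
  case: eqP => _; first by left; exists x.
  by case E: (r x) => [v|]; [right; exists x, v | left; exists x].
- by exists (pr (seq_pairing pr x) 0) => //=; rewrite pr1K pr2K.
- by exists (pr (seq_pairing pr x) 1) => //=; rewrite pr1K pr2K /= phiE rx.
Qed.

(** * The three properties of the numbering by modified programs *)

Section Numbering.

Variables (n : nat) (Sigma : alphabet) (kappa : nat -> n.+1.-tuple nat).
Variables (A : set nat) (e : nat -> nat).
Variables (M : program Sigma -> program Sigma) (MP : nat -> program Sigma).
Hypothesis kappa_enum : effective_tuple_enumeration kappa.
Hypothesis infA : infinite_set A.
Hypothesis e_enum : effective_enumeration e A.
Hypothesis modM : program_modification kappa e M.
Hypothesis enumMP : effective_program_enumeration MP (range M).

(** [z] is read as a coded point of the universal function with a step counter. A run that has not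
    halted yields the entry with 0, which belongs to the extended graph at every point. *)
Lemma numbering_QGN_I : QGN_I pr (fun i => Sem n.+1 (MP i)).
Proof.
have [cMP _ _] := enumMP.
(* The arguments are [[:: j, i & x]]. The counter [j = 0] is reserved for the entry with 0, and
   [j.+1] stands for a run of [j] steps. *)
pose p s := program_code (MP (nth 0 s 1)).
pose c s := run_input_code Sigma (p s) (drop 2 s) (nth 0 s 0).-1.
pose V s := if nth 0 s 0 == 0 then 0 else
  if halted_code Sigma (p s) (c s) then (output_code Sigma (c s)).+1 else 0.
have recp : recursive n.+3 p by apply: (recursive_op1 cMP); prove_recursive.
have recc : recursive n.+3 c.
  apply: (recursive_op3 (computable_run_code Sigma) recp); last by prove_recursive.
  have := recursive_behead (recursive_behead (recursive_input_code Sigma n.+1)).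
  by apply: recursive_ext => -[|a [|b s]] //= _; rewrite drop0.
have recV : recursive n.+3 V.
  have rech := recursive_halted_code Sigma recp recc.
  by have cout := computable_output_code Sigma; rewrite /V; prove_recursive.
have rec1 := recursive_op1 computable_pr1 (@recursive_nth 1 0 isT).
have rec2 := recursive_op1 computable_pr2 (@recursive_nth 1 0 isT).
have [Gs [sGs recGs eqGs]] := unpairing_recursive n.+1 rec1.
exists (fun z => pr (pr1 z) (V (pr2 z :: unpairing n.+1 (pr1 z)))).
  rewrite -recursive_computable1; apply: (recursive_op2 computable_pr rec1).
  have := @recursive_comp 1 _ _ ((fun s => pr2 (nth 0 s 0)) :: Gs) recV.
  rewrite [size _]/= sGs => /(_ erefl (conj rec2 recGs)); apply: recursive_ext => s _.
  by rewrite eqGs [map _ _]/=.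
have VE j (x : n.+2.-tuple nat) : V (j :: x) =
    if j is j'.+1 then
      if stops_within (MP (thead x)) (behead x) j'
      then (output (run (MP (thead x)) (behead x) j')).+1 else 0
    else 0.
  case/tupleP: x => i x; rewrite /V /c /p /= drop0 theadE.
  by case: j => //= j; rewrite run_input_codeE halted_codeE output_codeE.
apply/seteqP; split=> [z [t _ <-]|z [[x ->]|[x [v [ux ->]]]]] /=.
- have [x xE] := seq_pairing_surj n.+1 (pr1 t); rewrite xE seq_pairingK ?size_tuple // VE.
  case: (pr2 t) => [|j]; first by left; exists x.
  case: ifP => Hj; last by left; exists x.
  right; exists x, (output (run (MP (thead x)) (behead x) j)); split=> //.
  exact: (@Sem_stops _ _ _ [tuple of behead x] j Hj).
- exists (pr (seq_pairing pr x) 0) => //=.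
  by rewrite pr1K pr2K seq_pairingK ?size_tuple // VE.
- have /isSome_Sem[j Hj] : isSome (universal (fun i => Sem n.+1 (MP i)) x) by rewrite ux.
  exists (pr (seq_pairing pr x) j.+1) => //=.
  rewrite pr1K pr2K seq_pairingK ?size_tuple // VE Hj.
  by move: ux; rewrite /universal (Sem_stops Hj) => -[->].
Qed.

Lemma numbering_QGN_II : QGN_II pr A (fun i => Sem n.+1 (MP i)).
Proof.
move=> k ck; have [cMP _ rangeMP] := enumMP; have [[f cf codeM] _ SemM] := modM.
pose graph_point t i u := (pr1 (k i t) == u) && (0 < pr2 (k i t)).
(* On [[:: t, i & x]] a zero means that [k i t] carries a value at [x]. *)
pose F s := ~~ graph_point (nth 0 s 0) (nth 0 s 1) (seq_pairing pr (drop 2 s)) : nat.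
pose G s := (pr2 (k (nth 0 s 1) (nth 0 s 0))).-1.
have reck : recursive n.+3 (fun s => k (nth 0 s 1) (nth 0 s 0)).
  by prove_recursive.
have recF : recursive n.+3 F.
  have rec_drop : recursive n.+3 (fun s => seq_pairing pr (drop 2 s)).
    have := recursive_behead (recursive_behead (recursive_seq_pairing n.+1)).
    by apply: recursive_ext => -[|a [|b s]] //= _; rewrite drop0.
  by rewrite /F /graph_point; prove_recursive.
have recG : recursive n.+3 G.
  by rewrite /G; prove_recursive.
have [P cP SemP] := search_program Sigma (ltn0Sn n) recF recG.
have exMP i : exists j, program_code (MP j) == f (program_code (P i)).
  have : range M (M (P i)) by exists (P i).
  by rewrite -rangeMP => -[j _ jE]; exists j; rewrite jE codeM.
(* The code of [M (P i)] is computable from [i] through [f], and [MP] runs through the range of [M];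
   so this search is computable and always succeeds. *)
pose v i := ex_minn (exMP i).
exists v.
  rewrite -recursive_computable1.
  pose H s := program_code (MP (nth 0 s 0)) != f (program_code (P (nth 0 s 1))) : nat.
  apply: (@recursive_min 1 H).
    rewrite /H; prove_recursive.
      by apply: (recursive_op1 cMP); prove_recursive.
    by apply: (recursive_op1 cP); prove_recursive.
  case=> [|i []] //= _; rewrite /H /v /=; case: ex_minnP => j -> minj; split=> // j'.
  by case: eqP => // /eqP /minj; rewrite leqNgt => /negbTE->.
move=> i r SAr rk.
have -> : MP (v i) = M (P i).
  by apply: program_code_inj; rewrite codeM /v; case: ex_minnP => j /eqP.
suff rP : Sem n.+1 (P i) = r.
  by rewrite SemM (modified_function_id kappa_enum e_enum) // rP.
apply: funext => x; have [found none] := SemP i x.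
have FE t : F [:: t, i & x] = ~~ graph_point t i (seq_pairing pr x).
  by rewrite /F /= drop0.
(* Every hit carries the right value, since an extended graph has at most one positive entry per
   point. *)
have sound t : graph_point t i (seq_pairing pr x) -> r x = Some (G [:: t, i & x]).
  move=> /andP[/eqP kx k_gt0]; rewrite /G /=.
  have : range (k i) (k i t) by exists t.
  rewrite rk => -[[y ky]|[y [w [ry ky]]]]; first by move: k_gt0; rewrite ky pr2K.
  rewrite ky pr2K /= -ry; congr (r _).
  by apply: seq_pairing_inj; rewrite -kx ky pr1K.
have [ex|noex] := pselect (exists t, graph_point t i (seq_pairing pr x)).
  case: (ex_minnP ex) => t gt mint; rewrite (sound t gt); apply: found.
    by rewrite FE gt.
  by move=> z zt; rewrite FE; case: (boolP (graph_point _ _ _)) => // /mint; rewrite leqNgt zt.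
rewrite none => [|t]; last first.
  by rewrite FE; case: (boolP (graph_point _ _ _)) => // gt _; apply: noex; exists t.
case E: (r x) => [w|] //; exfalso; apply: noex.
have : extended_graph pr r (pr (seq_pairing pr x) w.+1) by right; exists x, w.
by rewrite -rk => -[t _ kt]; exists t; rewrite /graph_point kt pr1K pr2K eqxx.
Qed.

Lemma numbering_range : range (fun i => Sem n.+1 (MP i)) = SA n.+1 A.
Proof.
have [_ _ rangeMP] := enumMP; have [_ _ SemM] := modM.
apply/seteqP; split=> [_ [i _ <-]|r SAr] /=.
  have : range M (MP i) by rewrite -rangeMP; exists i.
  by move=> [P _ <-]; rewrite SemM; apply: modified_function_SA.
(* [k i] enumerates the same graph for every [i], so each value of [v] is an index of [r], in
   particular [v 0]. *)
have [k ck rk] := SA_extended_graph SAr; have [v _ rv] := numbering_QGN_II ck.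
by exists (v 0) => //; rewrite -(rv 0 r).
Qed.

End Numbering.

End Pairing.

Theorem theorem3p2 (n : nat) (Sigma : alphabet)
    (pr : nat -> nat -> nat) (kappa : nat -> n.-tuple nat)
    (A : set nat) (e : nat -> nat)
    (M : program Sigma -> program Sigma) (MP : nat -> program Sigma) :
  1 <= n ->
  computable_pairing pr ->
  effective_tuple_enumeration kappa ->
  infinite_set A ->
  effective_enumeration e A ->
  program_modification kappa e M ->
  effective_program_enumeration MP (range M) ->
  quasi_goedel_numbering pr A (fun i => Sem n (MP i)).
Proof.
case: n kappa => // n kappa _ pairing kappa_enum infA e_enum modM enumMP.
have [cpr _ _] := pairing.
have [pr1 [pr2 [cpr1 cpr2 pr1K pr2K prK]]] := computable_unpairing pairing.
split.
- exact: (numbering_range cpr cpr1 cpr2 pr1K pr2K prK kappa_enum infA e_enum modM enumMP).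
- exact: (numbering_QGN_I cpr cpr1 cpr2 pr1K pr2K prK n enumMP).
- move=> k ck.
  exact: (numbering_QGN_II cpr cpr1 cpr2 pr1K pr2K kappa_enum infA e_enum modM enumMP ck).
Qed.
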